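(* Let $(B_t;t\ge 0)$ be standard one-dimensional Brownian motion started at $0$. (1) Almost surely, there is no random time $T\ge 0$ such that $(B_{T+u}-B_T;0\le u\le 1)\in\mathcal{E}$. (2) Almost surely, there is no random time $T\ge 0$ such that $(B_{T+u}-B_T;0\le u\le 1)\in\mathcal{RBR}$. (3) Almost surely, there is no random time $T\ge 0$ such that $(B_{T+u}-B_T;0\le u\le 1)\in\mathcal{VB}^{-}$. (4) For each $\lambda<0$, almost surely, there is no random time $T\ge 0$ such that $(B_{T+u}-B_T;0\le u\le 1)\in\mathcal{FP}^{\lambda}$. (5) For each $\lambda<0$, almost surely, there is no random time $T\ge 0$ such that $(B_{T+u}-B_T;0\le u\le 1)\in\mathcal{VB}^{\lambda}$.
   Context: $\mathcal{C}[0,1]$ denotes the space of continuous real-valued paths $w$ on $[0,1]$ with $w(0)=0$. For $S\subset\mathcal{C}[0,1]$, ''almost surely, there is no random time $T$ such that $(B_{T+u}-B_T;0\le u\le1)\in S$'' means $\mathbb{P}[\exists\, T\ge 0 \text{ such that } (B_{T+u}-B_T;0\le u\le 1)\in S]=0$, i.e. with probability one no time $t\ge0$ whatsoever has $(B_{t+u}-B_t;0\le u\le1)\in S$. The sets of paths are: $\mathcal{E}:=\{w\in\mathcal{C}[0,1]; w(t)>w(1)=0 \text{ for } 0<t<1\}$ (excursion paths); $\mathcal{RBR}:=\{w\in\mathcal{C}[0,1]; w(t)\ge w(1)=0 \text{ for } 0\le t\le 1\}$ (reflected bridge paths); $\mathcal{VB}^{-}:=\{w\in\mathcal{C}[0,1];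 w(t)>w(1) \text{ for } 0\le t<1 \text{ and } \inf\{t>0;w(t)<0\}>0\}$; for $\lambda<0$, $\mathcal{FP}^{\lambda}:=\{w\in\mathcal{C}[0,1]; w(t)>w(1)=\lambda \text{ for } 0\le t<1\}$ (first passage bridge paths); for $\lambda<0$, $\mathcal{VB}^{\lambda}:=\{w\in\mathcal{FP}^{\lambda}; \inf\{t>0;w(t)<0\}>0\}=\{w\in\mathcal{VB}^{-};w(1)=\lambda\}$ (Vervaat bridge paths). *)

(* Defs.v *)
From mathcomp Require Import all_boot all_order all_algebra.
From mathcomp Require Import all_classical all_reals all_analysis.

Set Implicit Arguments.
Unset Strict Implicit.
Unset Printing Implicit Defensive.

Import Order.TTheory GRing.Theory Num.Theory.
Import numFieldNormedType.Exports.

Local Open Scope classical_set_scope.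
Local Open Scope ring_scope.

(* The product rule for subfamilies is the case where some A i are setT. *)
Definition mutually_independent (d : measure_display) (T : measurableType d)
    (R : realType) (P : probability T R) (n : nat) (X : 'I_n -> T -> R) : Prop :=
  forall A : 'I_n -> set R, (forall i, measurable (A i)) ->
    P (\bigcap_(i in [set: 'I_n]) (X i @^-1` A i)) =
    (\prod_(i < n) P (X i @^-1` A i))%E.

(* The process is indexed by R, but only its values at times t >= 0 matter.
   The second argument of normal_prob is the standard deviation; s < t is
   strict because normal_prob m 0 is not the Dirac mass at m. *)
Record brownian_motion (d : measure_display) (T : measurableType d)
    (R : realType) (P : probability T R) (B : R -> T -> R) : Prop := {
  bm_measurable : forall t, 0 <= t -> measurable_fun [set: T] (B t) ;
  bm_start : {ae P, forall omega, B 0 omega = 0} ;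
  bm_independent : forall (n : nat) (t : nat -> R),
    0 <= t 0%N -> {homo t : i j / (i <= j)%N >-> i <= j} ->
    mutually_independent P
      (fun (i : 'I_n) omega => B (t i.+1) omega - B (t i) omega) ;
  bm_gaussian : forall s t : R, 0 <= s -> s < t ->
    forall A : set R, measurable A ->
    P ((fun omega => B t omega - B s omega) @^-1` A) =
    normal_prob 0 (Num.sqrt (t - s)) A ;
  bm_continuous :
    {ae P, forall omega, {within `[0, +oo[, continuous (B ^~ omega)}}
}.

Definition almost_surely_no_embedding (d : measure_display)
    (T : measurableType d) (R : realType) (P : probability T R)
    (B : R -> T -> R) (S : set (R -> R)) : Prop :=
  {ae P, forall omega,
    ~ exists t : R, 0 <= t /\ S (fun u => B (t + u) omega - B t omega)}.

(* Paths on [0, 1] are represented by functions on R, of which only the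
   restriction to [0, 1] is ever constrained. *)
Definition C01 (R : realType) : set (R -> R) :=
  [set w : R -> R | {within `[(0 : R), 1], continuous w} /\ w 0 = 0].

Definition excursion (R : realType) : set (R -> R) :=
  [set w : R -> R | C01 w /\ w 1 = 0 /\ forall t, 0 < t < 1 -> w 1 < w t].

Definition reflected_bridge (R : realType) : set (R -> R) :=
  [set w : R -> R | C01 w /\ w 1 = 0 /\ forall t, 0 <= t <= 1 -> w 1 <= w t].

(* The infimum is taken in \bar R, so that inf set0 = +oo. *)
Definition first_negative_time (R : realType) (w : R -> R) : \bar R :=
  ereal_inf [set t%:E | t in [set t : R | 0 < t <= 1 /\ w t < 0]].

Definition vervaat_bridge_neg (R : realType) : set (R -> R) :=
  [set w : R -> R | C01 w /\ (forall t, 0 <= t < 1 -> w 1 < w t) /\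
           (0 < first_negative_time w)%E].

Definition first_passage_bridge (R : realType) (lambda : R) : set (R -> R) :=
  [set w : R -> R | C01 w /\ w 1 = lambda /\ forall t, 0 <= t < 1 -> w 1 < w t].

Definition vervaat_bridge (R : realType) (lambda : R) : set (R -> R) :=
  [set w : R -> R | first_passage_bridge lambda w /\ (0 < first_negative_time w)%E].

(* Main.v *)
From HB Require Import structures.
Require Import Defs.
From mathcomp Require Import all_boot all_order all_algebra.
From mathcomp Require Import all_classical all_reals all_analysis.
From mathcomp Require Import measurable_realfun ring lra zify.

(** Put a grid of mesh [1/q] on time, so that the increments of [B] form an
    i.i.d. symmetric walk [S], and let [stay k] be the probability that [k] steps
    of [S] never go below the start.  Splitting a path at its first minimum gives
    [sum_k stay k * stay (n - k) = 1], hence [stay k] is of order [k^(-1/2)].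

    At a bad time [t] two conditions of codimension 1/2 hold at once, which is the
    critical situation.  In the Vervaat case [B] has a local minimum
    from the right at [t] and from the left at [t + 1]; in the other cases [t + 1]
    is a minimum from the left and [B (t + 1) - B t] takes a prescribed value.  As for
    the hitting of points by planar Brownian motion, the expected number of grid
    hits stays bounded relative to its natural scale, while after the first hit the
    conditional expected number of further hits is larger by the divergent factor
    [sum 1/a].  So hits have probability [O(1/J)], where [2^J] is the ratio
    of the scales used, and [J] is arbitrary.

    For the Vervaat case, being a minimum from the right concerns the future; but
    given that [k] is such a minimum, whether [i < k] is one only depends on the path
    up to [k], so first hits can still be used.  A path with a bad time hits the grid
    because grid minimisers converge to a strict minimiser; strictness holds as
    Brownian local minima have distinct values almost surely. *)

Set Implicit Arguments.
Unset Strict Implicit.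
Unset Printing Implicit Defensive.

Import Order.TTheory GRing.Theory Num.Theory.
Import numFieldNormedType.Exports.

Local Open Scope classical_set_scope.
Local Open Scope ring_scope.

(** * Sequences of reals and i.i.d. laws *)

(** A bad time is confined to one of countably many windows of length [1/(2 N)]. With
    [q = N * (4 * A)] steps per unit of time and [A = 2 ^ J * L], the increments of index in [[0, 4
    A[] and in [[q, q + 4 A[] last [1/N] each and are independent. The grid minimisers attached to
    [t] and [t + 1] need not sit at corresponding grid points, so a hit tolerates an error of [L]
    steps, the fixed duration [1/(4 N 2^J)]; for bridges the tolerance is in space, the standard
    deviation of [l] steps. With [N] and [J] fixed the mesh is refined by letting [L] (or [l]) tend
    to infinity: a bad path hits every fine enough grid, and the bound [O(1/J)] is uniform. The
    factor [1/a] is a product of two factors of order [a^(-1/2)]: two one-sided conditions over [a]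
    more steps, or one such condition and a Gaussian of standard deviation [sqrt (a/q)] falling into
    an interval of width of order [sqrt (l/q)]. The second product is only valid if the one-sided
    condition has not moved the walk by more than a bounded number of standard deviations, whence
    the estimates on walks that stay on one side. *)

Definition cylinder (R : realType) (n : nat) (A : nat -> set R) : set (nat -> R) :=
  [set x | forall i, (i < n)%N -> A i (x i)].

Definition cylinders (R : realType) : set (set (nat -> R)) :=
  [set C | exists n A, (forall i, measurable (A i)) /\ C = cylinder n A].

(** The increments are seen as one random point of sequence space with its product sigma-algebra,
    where events can be shifted, reversed and resampled whatever the space carrying [B]. *)
Definition rseq (R : realType) := g_sigma_algebraType (@cylinders R).

Section rseq_measurability.
Context (R : realType).

Lemma measurable_cylinder n (A : nat -> set R) :
  (forall i, measurable (A i)) -> measurable (cylinder n A : set (rseq R)).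
Proof. by move=> mA; apply: sub_sigma_algebra; exists n, A. Qed.

Lemma measurable_coord i : measurable_fun setT (fun x : rseq R => x i).
Proof.
move=> _ A mA; rewrite setTI.
pose B j := if j == i then A else setT.
suff -> : (fun x : rseq R => x i) @^-1` A = cylinder i.+1 B.
  by apply: measurable_cylinder => j; rewrite /B; case: ifP.
apply/seteqP; split => x /=.
  by move=> Axi j _; rewrite /B; case: eqP => // ->.
by move/(_ i (ltnSn i)); rewrite /B eqxx.
Qed.

Lemma measurable_fun_rseq d (T : measurableType d) (f : T -> rseq R) :
  (forall i, measurable_fun setT (fun w => f w i)) -> measurable_fun setT f.
Proof.
move=> mf; apply: (measurability (@cylinders R : set (set (rseq R)))) => //.
move=> _ [_ [n [A [mA ->]]] <-]; rewrite setTI.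
have -> : f @^-1` cylinder n A =
    \bigcap_(i in [set i | (i < n)%N]) ((fun w => f w i) @^-1` A i).
  by apply/seteqP; split => w.
apply: bigcap_measurableType => i _.
by rewrite -[X in measurable X]setTI; exact: mf.
Qed.

(** Cylinders form a pi-system: two of them are intersected after padding the shorter one with
    [setT]. *)
Lemma rseq_measure_eq (m1 m2 : {measure set (rseq R) -> \bar R}) :
  (m1 setT < +oo)%E ->
  (forall n A, (forall i, measurable (A i)) -> m1 (cylinder n A) = m2 (cylinder n A)) ->
  forall E, measurable E -> m1 E = m2 E.
Proof.
move=> m1oo m12; apply: (@measure_unique _ R (rseq R) (@cylinders R) (fun=> setT) _ _ _ _ m1 m2) => //.
- move=> _ _ [n [A [mA ->]]] [k [B [mB ->]]].
  exists (maxn n k), (fun i => (if (i < n)%N then A i else setT) `&`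
                      (if (i < k)%N then B i else setT)); split.
    by move=> i; apply: measurableI; case: ifP.
  apply/seteqP; split => x /=.
    by move=> [Ax Bx] i _; split; case: ifP => // h; [exact: Ax|exact: Bx].
  move=> h; split => i ik.
    by have [] := h i; rewrite ?ik// (leq_trans ik)// leq_maxl.
  by have [] := h i; rewrite ?ik// (leq_trans ik)// leq_maxr.
- by move=> _; exists 0%N, (fun=> setT); split => //; apply/seteqP; split.
- by apply/seteqP; split => // x _; exists 0%N.
- by move=> _ [n [A [mA ->]]]; exact: m12.
Qed.

Lemma measurable_relabel (pi : nat -> nat) (f : nat -> R -> R) (E : set (rseq R)) :
  (forall i, measurable_fun setT (f i)) -> measurable E ->
  measurable [set x : rseq R | E (fun i => f i (x (pi i)))].
Proof.
move=> mf mE; pose phi (x : rseq R) : rseq R := fun i => f i (x (pi i)).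
have mphi : measurable_fun setT phi.
  by apply: measurable_fun_rseq => i; apply: measurableT_comp => //; exact: measurable_coord.
by rewrite -[X in measurable X]setTI; exact: (mphi measurableT _ mE).
Qed.

End rseq_measurability.

Definition iid_law (R : realType) (nu : set R -> \bar R) (Q : probability (rseq R) R) :=
  forall n A, (forall i, measurable (A i)) ->
    Q (cylinder n A) = (\prod_(i < n) nu (A i))%E.

(** Resampling of the coordinates in [I]. It replaces conditioning on the coordinates outside
    [I]. *)
Definition splice (R : realType) (I : pred nat) (z : rseq R * rseq R) : rseq R :=
  fun i => if I i then z.2 i else z.1 i.

Definition determined (R : realType) (I : pred nat) (E : set (rseq R)) :=
  forall x y : rseq R, (forall i, I i -> x i = y i) -> E x -> E y.

(** * Relabelling and resampling of i.i.d. sequences *)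

Section iid.
Context (R : realType) (nu : set R -> \bar R) (Q : probability (rseq R) R).
Hypothesis iidQ : iid_law nu Q.

Let nu_setT : nu setT = 1%E.
Proof.
have := @iidQ 1 (fun=> setT) (fun=> measurableT); rewrite big_ord1 => <-.
rewrite (_ : cylinder 1 _ = setT) ?probability_setT//.
by apply/seteqP; split.
Qed.

Lemma iid_uniq_seq (s : seq nat) (A : nat -> set R) : uniq s ->
  (forall i, measurable (A i)) ->
  Q [set x | forall i, i \in s -> A i (x i)] = (\prod_(i <- s) nu (A i))%E.
Proof.
move=> us mA; pose n := (\max_(i <- s) i).+1.
have sn i : i \in s -> (i < n)%N by move=> si; rewrite ltnS; exact: leq_bigmax_seq.
pose B i := if i \in s then A i else setT.
have -> : [set x | forall i, i \in s -> A i (x i)] = cylinder n B.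
  apply/seteqP; split => x /= h i; rewrite /B.
    by move=> _; case: ifP => // /h.
  by move=> si; have := h i (sn i si); rewrite /B si.
rewrite iidQ; last by move=> i; rewrite /B; case: ifP.
rewrite -(big_mkord xpredT (fun i => nu (B i))).
rewrite (bigID (mem s)) /= [X in (_ * X)%E]big1 ?mule1; last first.
  by move=> i /negbTE si; rewrite /B si nu_setT.
rewrite -big_filter.
have ts : perm_eq [seq i <- index_iota 0 n | i \in s] s.
  apply: uniq_perm => //; first by rewrite filter_uniq// iota_uniq.
  by move=> i; rewrite mem_filter mem_index_iota /=; case: (boolP (i \in s)) => // /sn ->.
by rewrite (perm_big _ ts) big_seq [RHS]big_seq; apply: eq_bigr => i si; rewrite /B si.
Qed.

Lemma iid_relabel (pi : nat -> nat) (f : nat -> R -> R) : injective pi ->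
  (forall i, measurable_fun setT (f i)) ->
  (forall i A, measurable A -> nu (f i @^-1` A) = nu A) ->
  forall E : set (rseq R), measurable E -> Q [set x | E (fun i => f i (x (pi i)))] = Q E.
Proof.
move=> ipi mf nuf E mE.
pose phi (x : rseq R) : rseq R := fun i => f i (x (pi i)).
have mphi : measurable_fun setT phi.
  by apply: measurable_fun_rseq => i; apply: measurableT_comp => //; exact: measurable_coord.
pose phi' : {mfun rseq R >-> rseq R} := HB.pack phi (isMeasurableFun.Build _ _ _ _ _ mphi).
suff : distribution Q phi' E = Q E by [].
apply/esym; apply: rseq_measure_eq => //; 
  first exact: (le_lt_trans (probability_le1 Q measurableT) (ltry 1)).
move=> n A mA; apply: (eq_trans (iidQ _ mA)); rewrite /distribution /pushforward /=.
(* [B j] collects the constraints on coordinate [j]: at most one set since [pi] is injective, and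
   [setT] when [j] is not a value of [pi]. *)
pose B j := \bigcap_(i in [set i | pi i = j]) (f i @^-1` A i).
have Bpi i : B (pi i) = f i @^-1` A i.
  by apply/seteqP; split => [x /(_ i erefl)//|x h k /= /ipi ->].
have phiA : phi @^-1` cylinder n A =
    [set x | forall j, j \in [seq pi i | i <- iota 0 n] -> B j (x j)].
  apply/seteqP; split => x /= h.
    move=> j /mapP[i]; rewrite mem_iota /= add0n => /h hi ->.
    by rewrite Bpi.
  move=> i ilt; have := h (pi i); rewrite Bpi => /=; apply; apply/mapP; exists i => //.
  by rewrite mem_iota.
apply: (eq_trans _ (congr1 Q (esym phiA))); rewrite iid_uniq_seq; last 2 first.
- by rewrite map_inj_uniq// iota_uniq.
- move=> j; apply: bigcap_measurableType => i _.
  by rewrite -[X in measurable X]setTI; exact: mf.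
apply/esym; rewrite big_map -{1}[n in iota 0 n]subn0 -/(index_iota 0 n) big_mkord.
by apply: eq_bigr => i _; rewrite Bpi nuf.
Qed.

Lemma measurable_splice I : measurable_fun setT (@splice R I).
Proof.
apply: measurable_fun_rseq => i; rewrite /splice; case: (I i).
  exact: (measurableT_comp (@measurable_coord R i) measurable_snd).
exact: (measurableT_comp (@measurable_coord R i) measurable_fst).
Qed.

Lemma measurable_section I (E : set (rseq R)) x : measurable E ->
  measurable [set y | E (splice I (x, y))].
Proof.
move=> mE.
have -> : [set y | E (splice I (x, y))] = xsection (@splice R I @^-1` E) x.
  by apply/seteqP; split => y /=; rewrite /xsection /= ?inE.
apply: measurable_xsection; rewrite -[X in measurable X]setTI.
exact: measurable_splice.
Qed.

(** Splicing maps [Q \x Q] to [Q]: on a cylinder each index takes its factor from exactly one of the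
    two independent copies. The integral is then Fubini. *)
Lemma iid_spliceE I (E : set (rseq R)) : measurable E ->
  Q E = (\int[Q]_x Q [set y | E (splice I (x, y))])%E.
Proof.
move=> mE.
pose phi' : {mfun (rseq R * rseq R)%type >-> rseq R} :=
  HB.pack (@splice R I) (isMeasurableFun.Build _ _ _ _ _ (@measurable_splice I)).
have -> : (\int[Q]_x Q [set y | E (splice I (x, y))])%E = pushforward (Q \x Q)%E phi' E.
  rewrite /pushforward /product_measure1; apply: eq_integral => x _ /=.
  by congr (Q _); apply/seteqP; split => y /=; rewrite /xsection /= ?inE.
apply: rseq_measure_eq => //; 
  first exact: (le_lt_trans (probability_le1 Q measurableT) (ltry 1)).
move=> n A mA; apply: (eq_trans (iidQ _ mA)); rewrite /pushforward.
pose AI i := if I i then A i else setT.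
pose AC i := if I i then setT else A i.
have phiA : @splice R I @^-1` cylinder n A = cylinder n AC `*` cylinder n AI.
  apply/seteqP; split => -[x y] /=.
    move=> h; split => i /h; rewrite /splice /= /AC /AI; case: (I i) => //.
  move=> [hC hI] i ilt; have := hC i ilt; have := hI i ilt.
  by rewrite /AC /AI /splice /=; case: (I i).
have mAC i : measurable (AC i) by rewrite /AC; case: ifP.
have mAI i : measurable (AI i) by rewrite /AI; case: ifP.
apply: (eq_trans _ (congr1 (Q \x Q)%E (esym phiA))).
rewrite product_measure1E; [|exact: measurable_cylinder..].
apply: (eq_trans _ (esym (congr2 mule (iidQ n mAC) (iidQ n mAI)))).
rewrite -big_split /=; apply: eq_bigr => i _.
by rewrite /AC /AI; case: ifP => _; rewrite nu_setT ?mul1e ?mule1.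
Qed.

End iid.

(** * Counting bounds for probabilities *)

Definition pr d (T : measurableType d) (R : realType) (P : probability T R)
  (E : set T) : R := fine (P E).

Section real_probability.
Context d (T : measurableType d) (R : realType) (P : probability T R).
Implicit Types E F : set T.

Lemma prE E : measurable E -> P E = (pr P E)%:E.
Proof. by move=> mE; rewrite /pr fineK// fin_num_measure. Qed.

Lemma pr_ge0 E : 0 <= pr P E.
Proof. by rewrite /pr fine_ge0. Qed.

Lemma pr_setT : pr P setT = 1.
Proof. by rewrite /pr probability_setT. Qed.

Lemma le_pr E F : measurable E -> measurable F -> E `<=` F -> pr P E <= pr P F.
Proof.
by move=> mE mF EF; rewrite -lee_fin -!prE// le_measure ?inE.
Qed.

(** Integration of an inequality between counting functions. The union bound, the packing of
    disjoint events and the bounded overlap of events are all instances. *)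
Lemma pr_sum_le (I J : Type) (r : seq I) (s : seq J) (A : I -> set T) (B : J -> set T)
    (C : R) : (forall i, measurable (A i)) -> (forall j, measurable (B j)) ->
  0 <= C ->
  (forall x, \sum_(i <- r) \1_(A i) x <= C * \sum_(j <- s) \1_(B j) x :> R) ->
  \sum_(i <- r) pr P (A i) <= C * \sum_(j <- s) pr P (B j).
Proof.
move=> mA mB C0 AB.
have ex K (t : seq K) (D : K -> set T) : (forall k, measurable (D k)) ->
    (\int[P]_x (\sum_(k <- t) \1_(D k) x)%:E)%E = (\sum_(k <- t) pr P (D k))%:E.
  move=> mD; under eq_integral do rewrite -sumEFin.
  rewrite ge0_integral_sum//=; last first.
    by move=> k; apply/measurable_EFinP; exact: measurable_indic.
  by rewrite -sumEFin; apply: eq_bigr => k _; rewrite integral_indic// setIT; exact: prE.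
rewrite -lee_fin EFinM -!ex// -ge0_integralZl_EFin//; first last.
- apply/measurable_EFinP; apply: measurable_sum => j; exact: measurable_indic.
- by move=> x _; rewrite lee_fin sumr_ge0.
apply: ge0_le_integral => //.
- by move=> x _; rewrite lee_fin sumr_ge0.
- apply/measurable_EFinP; apply: measurable_sum => i; exact: measurable_indic.
- apply: emeasurable_funM => //.
  by apply/measurable_EFinP; apply: measurable_sum => j; exact: measurable_indic.
- by move=> x _; rewrite -EFinM lee_fin.
Qed.

Lemma pr_union_le (I : eqType) (r : seq I) (A : I -> set T) E : measurable E ->
  (forall i, measurable (A i)) -> (forall x, E x -> exists2 i, i \in r & A i x) ->
  pr P E <= \sum_(i <- r) pr P (A i).
Proof.
move=> mE mA EA.
have := @pr_sum_le _ _ [:: tt] r (fun=> E) A 1.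
rewrite !big_seq1 !mul1r; apply => // x; rewrite big_seq1 mul1r.
rewrite indicE; case: (boolP (x \in E)) => [|_]; last by rewrite sumr_ge0.
move=> /set_mem /EA [i ir Aix].
rewrite (big_rem i)//= indicE mem_set//= lerDl sumr_ge0//.
Qed.

Lemma pr_disjoint_le (I : eqType) (r : seq I) (A : I -> set T) E : measurable E ->
  (forall i, measurable (A i)) -> uniq r ->
  (forall i x, i \in r -> A i x -> E x) ->
  (forall i j x, i \in r -> j \in r -> A i x -> A j x -> i = j) ->
  \sum_(i <- r) pr P (A i) <= pr P E.
Proof.
move=> mE mA ur AE Adisj.
have := @pr_sum_le _ _ r [:: tt] A (fun=> E) 1.
rewrite !big_seq1 !mul1r; apply => // x; rewrite big_seq1 mul1r.
case: (pselect (exists2 i, i \in r & A i x)) => [[i ir Aix]|nex].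
  rewrite (bigD1_seq i)//= big_seq_cond big1 ?addr0; last first.
    move=> j /andP[jr /eqP ji]; rewrite indicE memNset// => Ajx.
    by apply: ji; apply: Adisj Ajx Aix.
  by rewrite !indicE !mem_set//; exact: AE Aix.
rewrite big_seq_cond big1 ?indicE//= => j /andP[jr _].
by rewrite indicE memNset// => Ajx; apply: nex; exists j.
Qed.

End real_probability.

Section iid_bounds.
Context (R : realType) (nu : set R -> \bar R) (Q : probability (rseq R) R).
Hypothesis iidQ : iid_law nu Q.
Implicit Types (E F : set (rseq R)) (I J : pred nat).

(** In [iid_spliceE], [x] carries the coordinates outside [I], and the section in [y] plays the role
    of the conditional probability of [E] given them. *)
Lemma pr_splice_le I E F c : measurable E -> measurable F -> 0 <= c ->
  (forall x y, E (splice I (x, y)) -> F x) ->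
  (forall x, F x -> pr Q [set y | E (splice I (x, y))] <= c) ->
  pr Q E <= c * pr Q F.
Proof.
move=> mE mF c0 EF Ec.
rewrite -lee_fin EFinM -!prE// (iid_spliceE iidQ I mE).
rewrite -[X in (_ * Q X)%E]setIT -integral_indic// -ge0_integralZl_EFin//; last first.
  by apply/measurable_EFinP; exact: measurable_indic.
have mS x : measurable [set y | E (splice I (x, y))] by exact: measurable_section.
rewrite (eq_integral (fun x => (pr Q [set y | E (splice I (x, y))])%:E)); last first.
  by move=> x _; rewrite prE.
apply: ge0_le_integral => //.
- by move=> x _; rewrite lee_fin pr_ge0.
- rewrite (_ : (fun x => _) = (fun x => Q (xsection (@splice R I @^-1` E) x))).
    apply: measurable_fun_xsection; rewrite -[X in measurable X]setTI.
    exact: measurable_splice.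
  apply/funext => x; rewrite -prE//; congr (Q _).
  by apply/seteqP; split => y /=; rewrite /xsection /= ?inE.
- apply: emeasurable_funM => //.
  by apply/measurable_EFinP; exact: measurable_indic.
move=> x _; rewrite -EFinM lee_fin indicE.
case: (boolP (x \in F)) => [/set_mem Fx|nF]; first by rewrite mulr1 Ec.
rewrite mulr0 (_ : [set y | _] = set0) /pr ?measure0//.
apply/seteqP; split => // y /EF Fx; move: nF; rewrite notin_setE => /(_ Fx) //.
Qed.

Lemma pr_splice_ge I E F c : measurable E -> measurable F -> 0 <= c ->
  (forall x, F x -> c <= pr Q [set y | E (splice I (x, y))]) ->
  c * pr Q F <= pr Q E.
Proof.
move=> mE mF c0 Ec.
rewrite -lee_fin EFinM -!prE// (iid_spliceE iidQ I mE).
rewrite -[X in (_ * Q X)%E]setIT -integral_indic// -ge0_integralZl_EFin//; last first.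
  by apply/measurable_EFinP; exact: measurable_indic.
have mS x : measurable [set y | E (splice I (x, y))] by exact: measurable_section.
rewrite [leRHS](eq_integral (fun x => (pr Q [set y | E (splice I (x, y))])%:E)); last first.
  by move=> x _; rewrite prE.
apply: ge0_le_integral => //.
- by move=> x _; rewrite -EFinM lee_fin mulr_ge0.
- apply: emeasurable_funM => //.
  by apply/measurable_EFinP; exact: measurable_indic.
- rewrite (_ : (fun x => _) = (fun x => Q (xsection (@splice R I @^-1` E) x))).
    apply: measurable_fun_xsection; rewrite -[X in measurable X]setTI.
    exact: measurable_splice.
  apply/funext => x; rewrite -prE//; congr (Q _).
  by apply/seteqP; split => y /=; rewrite /xsection /= ?inE.
move=> x _; rewrite -EFinM lee_fin indicE.
case: (boolP (x \in F)) => [/set_mem Fx|nF]; first by rewrite mulr1 Ec.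
by rewrite mulr0 pr_ge0.
Qed.

(** Resampling [I] leaves [F] unchanged and makes the section equal to [E] for every [x] in [F], so
    both splicing bounds apply with [c = pr Q E]. *)
Lemma pr_indep I J E F : measurable E -> measurable F ->
  determined I E -> determined J F -> (forall i, I i -> ~~ J i) ->
  pr Q (E `&` F) = pr Q E * pr Q F.
Proof.
move=> mE mF dE dF IJ; have mEF := measurableI _ _ mE mF.
have Emerge x y : E (splice I (x, y)) <-> E y.
  by split; apply: dE => i Ii; rewrite /splice /= Ii.
have Fmerge x y : F (splice I (x, y)) <-> F x.
  by split; apply: dF => i Ji; rewrite /splice /=; case: ifP => // /IJ; rewrite Ji.
have sec x : F x -> [set y | (E `&` F) (splice I (x, y))] = E.
  move=> Fx; apply/seteqP; split => y /=; first by move=> [/Emerge].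
  by move=> Ey; split; [exact/Emerge|exact/Fmerge].
apply/eqP; rewrite eq_le; apply/andP; split.
  apply: (@pr_splice_le I) => //; first exact: pr_ge0.
    by move=> x y [_ /Fmerge].
  by move=> x /sec ->.
apply: (@pr_splice_ge I) => //; first exact: pr_ge0.
by move=> x /sec ->.
Qed.

End iid_bounds.

(** * Symmetric walks *)

Definition bl (R : realType) (x : nat -> R) (a b : nat) : R := \sum_(a <= i < b) x i.

(** With [bl x a b] the increment of the walk, [Fut a b] makes [a] a weak minimum over [[a, b]], and
    [Past a b] makes [b] a strict one. This asymmetry singles out the first minimum: exactly one [k]
    satisfies both [Past 0 k] and [Fut k n]. *)
Definition Fut (R : realType) (a b : nat) : set (rseq R) :=
  [set x | forall j, (a <= j <= b)%N -> 0 <= bl x a j].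

Definition Past (R : realType) (a b : nat) : set (rseq R) :=
  [set x | forall j, (a <= j < b)%N -> bl x j b < 0].

Lemma first_argmin (R : realDomainType) (f : nat -> R) n : exists2 k, (k <= n)%N &
  (forall j, (j < k)%N -> f k < f j) /\ (forall j, (k <= j <= n)%N -> f k <= f j).
Proof.
elim: n => [|n [k kn [lek gek]]].
  by exists 0%N => //; split => // j; rewrite leqn0 => /eqP ->.
have [fnk|fkn] := ltP (f n.+1) (f k).
  exists n.+1 => //; split => j.
    rewrite ltnS => jn; have [jk|kj] := ltnP j k.
      exact: lt_trans fnk (lek _ jk).
    by apply: lt_le_trans fnk _; apply: gek; rewrite kj.
  by rewrite -eqn_leq => /eqP <-.
exists k; first exact: leqW.
split => // j /andP[kj]; rewrite leq_eqVlt => /predU1P[->//|].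
by rewrite ltnS => jn; apply: gek; rewrite kj.
Qed.

Section measurable_events.
Context d (T : measurableType d) (R : realType).

Lemma measurable_forall (F : nat -> set T) :
  (forall i, measurable (F i)) -> measurable [set x | forall i, F i x].
Proof.
move=> mF; rewrite (_ : [set x | _] = \bigcap_i F i).
  exact: bigcapT_measurable.
by apply/seteqP; split => x /= h i => [_|]; exact: h.
Qed.

Lemma measurable_exists (F : nat -> set T) :
  (forall i, measurable (F i)) -> measurable [set x | exists i, F i x].
Proof.
move=> mF; rewrite (_ : [set x | _] = \bigcup_i F i).
  exact: bigcupT_measurable.
by apply/seteqP; split => x /= [i]; [exists i|exists i].
Qed.

Lemma measurable_imply (p : Prop) (F : set T) :
  measurable F -> measurable [set x | p -> F x].
Proof.
move=> mF; have [hp|hp] := pselect p.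
  by rewrite (_ : [set x | _] = F)//; apply/seteqP; split => x /=; auto.
by rewrite (_ : [set x | _] = setT)//; apply/seteqP; split => x //= _ /hp.
Qed.

Lemma measurable_conj (p : Prop) (F : set T) :
  measurable F -> measurable [set x | p /\ F x].
Proof.
move=> mF; have [hp|hp] := pselect p.
  by rewrite (_ : [set x | _] = F)//; apply/seteqP; split => x /=; tauto.
by rewrite (_ : [set x | _] = set0)//; apply/seteqP; split => x //= [].
Qed.

Lemma measurable_and_set (F G : set T) :
  measurable F -> measurable G -> measurable [set x | F x /\ G x].
Proof. exact: measurableI. Qed.

Lemma measurable_not (F : set T) : measurable F -> measurable [set x | ~ F x].
Proof. exact: measurableC. Qed.

Lemma measurable_lt_set (f g : T -> R) : measurable_fun setT f -> measurable_fun setT g ->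
  measurable [set x | f x < g x].
Proof.
by move=> mf mg; move: (measurable_fun_ltr mf mg) => /(_ measurableT [set true]); rewrite setTI; apply.
Qed.

Lemma measurable_le_set (f g : T -> R) : measurable_fun setT f -> measurable_fun setT g ->
  measurable [set x | f x <= g x].
Proof.
by move=> mf mg; move: (measurable_fun_ler mf mg) => /(_ measurableT [set true]); rewrite setTI; apply.
Qed.

End measurable_events.

Section blocks.
Context (R : realType).
Implicit Types x y : rseq R.

Lemma bl_nil x a : bl x a a = 0.
Proof. by rewrite /bl big_geq. Qed.

Lemma bl_cat x a b c : (a <= b)%N -> (b <= c)%N -> bl x a c = bl x a b + bl x b c.
Proof. by move=> ab bc; rewrite /bl (big_cat_nat ab bc). Qed.

Lemma eq_bl x y a b : (forall i, (a <= i < b)%N -> x i = y i) -> bl x a b = bl y a b.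
Proof. by move=> xy; apply: eq_big_nat. Qed.

Lemma measurable_bl a b : measurable_fun setT (fun x : rseq R => bl x a b).
Proof. by apply: measurable_sum => i; exact: measurable_coord. Qed.

Lemma measurable_Fut a b : measurable (Fut a b : set (rseq R)).
Proof.
apply: measurable_forall => j; apply: measurable_imply.
by apply: measurable_le_set => //; exact: measurable_bl.
Qed.

Lemma measurable_Past a b : measurable (Past a b : set (rseq R)).
Proof.
apply: measurable_forall => j; apply: measurable_imply.
by apply: measurable_lt_set => //; exact: measurable_bl.
Qed.

Lemma Fut_cat x i k n : (i <= k)%N -> Fut i k x -> Fut k n x -> Fut i n x.
Proof.
move=> ik Fik Fkn j /andP[ij jn]; have [jk|kj] := leqP j k.
  by apply: Fik; rewrite ij.
rewrite (bl_cat _ ik (ltnW kj)) addr_ge0//; first by apply: Fik; rewrite ik leqnn.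
by apply: Fkn; rewrite (ltnW kj).
Qed.

Lemma Past_cat x i k n : (k <= n)%N -> Past i k x -> Past k n x -> Past i n x.
Proof.
move=> kn Pik Pkn j /andP[ij jn]; have [kj|jk] := leqP k j.
  by apply: Pkn; rewrite kj.
have Pj : bl x j k < 0 by apply: Pik; rewrite ij.
rewrite (bl_cat _ (ltnW jk) kn); move: kn; rewrite leq_eqVlt => /predU1P[<-|kn].
  by rewrite bl_nil addr0.
by rewrite -[ltRHS]addr0 ltrD// Pkn// leqnn.
Qed.

Lemma determined_Fut a b : determined (fun i => a <= i < b)%N (Fut a b : set (rseq R)).
Proof.
move=> x y xy h j /andP[aj jb]; rewrite -(@eq_bl x y); first by apply: h; rewrite aj.
by move=> i /andP[ai ij]; apply: xy; rewrite ai (leq_trans ij).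
Qed.

Lemma determined_Past a b : determined (fun i => a <= i < b)%N (Past a b : set (rseq R)).
Proof.
move=> x y xy h j /andP[aj jb]; rewrite -(@eq_bl x y); first by apply: h; rewrite aj.
by move=> i /andP[ji ib]; apply: xy; rewrite (leq_trans aj).
Qed.

Lemma determinedI (I J : pred nat) (E F : set (rseq R)) :
  determined I E -> determined J F -> determined (predU I J) (E `&` F).
Proof.
move=> dE dF x y xy [Ex Fx]; split.
  by apply: dE Ex => i Ii; apply: xy; rewrite /= Ii.
by apply: dF Fx => i Ji; apply: xy; rewrite /= Ji orbT.
Qed.

End blocks.

(** Reverses the first [b] coordinates and fixes the others, hence is injective on all indices. With
    a change of sign it turns the walk [S] into [S (b - j) - S b], so that a minimum seen from the
    past becomes one seen from the future. *)
Definition reflect_index b i := if (i < b)%N then (b.-1 - i)%N else i.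

Section symmetric_walk.
Context (R : realType) (nu : set R -> \bar R) (Q : probability (rseq R) R).
Hypothesis iidQ : iid_law nu Q.
Hypothesis nuN : forall A : set R, measurable A -> nu (-%R @^-1` A) = nu A.
Hypothesis noatom : forall a b, (a < b)%N -> pr Q [set x | bl x a b = 0] = 0.

Lemma pr_shift a (E : set (rseq R)) : measurable E ->
  pr Q [set x | E (fun i => x (a + i)%N)] = pr Q E.
Proof.
move=> mE; rewrite /pr (iid_relabel iidQ (f := fun _ => id) _ _ _ mE)//.
exact: addnI.
Qed.

Lemma bl_shift (x : rseq R) a b c : bl (fun i => x (a + i)%N) b c = bl x (a + b) (a + c).
Proof. by rewrite /bl (addnC a b) (addnC a c) [RHS]big_addn addnK; apply: eq_bigr => i _; rewrite addnC. Qed.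

Lemma reflect_indexK b : involutive (reflect_index b).
Proof.
move=> i; rewrite /reflect_index; have [ib|ib] := ltnP i b; first by rewrite ifT; lia.
by rewrite ltnNge ib.
Qed.

Lemma pr_reverse b (E : set (rseq R)) : measurable E ->
  pr Q [set x | E (fun i => - x (reflect_index b i))] = pr Q E.
Proof.
move=> mE; rewrite /pr (iid_relabel iidQ (f := fun _ => -%R) _ _ _ mE)//.
exact: inv_inj (reflect_indexK b).
Qed.

Lemma bl_reverse (x : rseq R) b j : (j <= b)%N ->
  bl (fun i => - x (reflect_index b i)) 0 j = - bl x (b - j) b.
Proof.
elim: j => [|j IH] jb; first by rewrite subn0 !bl_nil oppr0.
have -> : bl (fun i => - x (reflect_index b i)) 0 j.+1 = bl (fun i => - x (reflect_index b i)) 0 j - x (reflect_index b j).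
  by rewrite /bl big_nat_recr.
rewrite IH ?(ltnW jb)// /reflect_index jb.
have -> : (b - j = (b - j.+1).+1)%N by lia.
have -> : (b.-1 - j = b - j.+1)%N by lia.
by rewrite [in RHS]/bl big_ltn ?opprD 1?addrC//; lia.
Qed.

Definition stay k := pr Q (Fut 0 k).

Lemma pr_Fut a b : pr Q (Fut a b) = stay (b - a).
Proof.
rewrite /stay -[RHS](pr_shift a); last exact: measurable_Fut.
congr (pr Q _).
apply/seteqP; split => x /= h j /andP[aj jb].
  rewrite bl_shift addn0; case: j => [|j] in aj jb *; first by rewrite addn0 bl_nil.
  by apply: h; lia.
have := h (j - a)%N; rewrite bl_shift addn0 subnKC//; apply; lia.
Qed.

Let FutS k : set (rseq R) := [set x | forall j, (0 < j <= k)%N -> 0 < bl x 0 j].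

Let measurable_FutS k : measurable (FutS k).
Proof.
apply: measurable_forall => j; apply: measurable_imply.
by apply: measurable_lt_set => //; exact: measurable_bl.
Qed.

(** Weak and strict positivity differ by a return to 0, which is null. The strict form is needed
    because it is what time reversal makes of [Past]. *)
Let pr_FutS k : pr Q (FutS k) = stay k.
Proof.
apply/eqP; rewrite eq_le; apply/andP; split.
  apply: le_pr => //; first exact: measurable_Fut.
  move=> x h [|j] /andP[_ jk]; first by rewrite bl_nil.
  by apply/ltW/h.
have mz j : measurable [set x : rseq R | bl x 0 j = 0].
  rewrite (_ : [set x : rseq R | _] = (fun x => bl x 0 j) @^-1` [set 0])//.
  by rewrite -[X in measurable X]setTI; exact: measurable_bl.
pose A i : set (rseq R) := if i == 0%N then FutS k else [set x | bl x 0 i = 0].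
have mA i : measurable (A i) by rewrite /A; case: ifP.
have := @pr_union_le _ _ _ Q _ (iota 0 k.+1) A (Fut 0 k) (measurable_Fut _ _) mA.
rewrite /= big_cons [X in _ + X]big_seq [X in _ + X]big1 ?addr0; last first.
  by move=> i; rewrite mem_iota /A => /andP[i0 _]; rewrite eqn0Ngt i0 noatom.
apply => x h.
have [[j [j0 [jk xj]]]|hn] := pselect (exists j, (0 < j)%N /\ (j <= k)%N /\ bl x 0 j = 0).
  by exists j; [rewrite inE mem_iota; lia|rewrite /A eqn0Ngt j0].
exists 0%N; first by rewrite inE.
move=> j /andP[j0 jk]; rewrite lt_neqAle h// andbT eq_sym.
by apply/eqP => xj; apply: hn; exists j.
Qed.

Lemma pr_Past a b : (a <= b)%N -> pr Q (Past a b) = stay (b - a).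
Proof.
move=> ab; rewrite -pr_FutS -[RHS](pr_reverse b)//; congr (pr Q _).
apply/seteqP; split => x /= h j /andP[aj jb].
  by rewrite bl_reverse ?oppr_gt0; [apply: h|]; lia.
have := h (b - j)%N; rewrite bl_reverse ?subKn ?oppr_gt0; [apply; lia|lia|lia].
Qed.

Lemma stay_convolution n : \sum_(0 <= k < n.+1) stay k * stay (n - k) = 1.
Proof.
have stayE k : (k <= n)%N -> stay k * stay (n - k) = pr Q (Past 0 k `&` Fut k n).
  move=> kn; rewrite (pr_indep iidQ _ _ (@determined_Past R 0 k) (@determined_Fut R k n)).
  - by rewrite pr_Past// pr_Fut subn0.
  - exact: measurable_Past.
  - exact: measurable_Fut.
  - by move=> i /andP[_ ik]; rewrite leqNgt ik.
rewrite (eq_big_nat _ _ (F2 := fun k => pr Q (Past 0 k `&` Fut k n))); last first.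
  by move=> k; rewrite ltnS => kn; exact: stayE.
have mPF k : measurable (Past 0 k `&` Fut k n : set (rseq R)).
  by apply: measurableI; [exact: measurable_Past|exact: measurable_Fut].
apply/eqP; rewrite eq_le -(pr_setT Q); apply/andP; split.
  apply: pr_disjoint_le => //; first exact: iota_uniq.
  suff H i j (x : rseq R) : (i < j)%N -> (j <= n)%N -> Fut i n x -> Past 0 j x -> False.
    move=> i j x; rewrite !mem_index_iota !ltnS => /= iin jn [Pi Fi] [Pj Fj].
    case: (ltngtP i j) => // ij; [case: (H i j x)|case: (H j i x)] => //.
  move=> ij jn Fi Pj; have := Fi j; have := Pj i; rewrite ij (ltnW ij) jn => /(_ isT).
  by rewrite ltNge => /negP h /(_ isT)/h.
apply: pr_union_le => // x _.
have [k kn [Pk Fk]] := first_argmin (bl x 0) n.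
exists k; first by rewrite mem_index_iota.
split => j /=.
  by move=> jk; rewrite -(ltrD2l (bl x 0 j)) -bl_cat// ?addr0 ?Pk// ltnW.
by move=> /andP[kj jn]; rewrite -(lerD2l (bl x 0 k)) -bl_cat// addr0 Fk// kj.
Qed.

Lemma stay_nonincreasing m n : (m <= n)%N -> stay n <= stay m.
Proof.
move=> mn; apply: le_pr; [exact: measurable_Fut..|].
by move=> x h j /andP[_ jm]; apply: h; rewrite (leq_trans jm).
Qed.

Lemma stay_ge0 k : 0 <= stay k. Proof. exact: pr_ge0. Qed.

End symmetric_walk.

(** * Nonincreasing sequences with constant self-convolution *)

Section self_convolution.
Context (R : realType) (s : nat -> R).
Hypothesis s_ge0 : forall k, 0 <= s k.
Hypothesis s_noninc : forall m n, (m <= n)%N -> s n <= s m.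
Hypothesis s_conv : forall n, \sum_(0 <= k < n.+1) s k * s (n - k) = 1.

(** Telescoping: [1/v <= 2 (v - u)] when [v^2 = u^2 + 1]. *)
Lemma sum_inv_sqrt_le n :
  \sum_(0 <= k < n) (Num.sqrt k.+1%:R)^-1 <= 2 * Num.sqrt n%:R :> R.
Proof.
elim: n => [|n IH]; first by rewrite big_geq// mulr_ge0.
rewrite big_nat_recr//=; apply: le_trans (lerD IH (lexx _)) _.
have n1 : 0 < n.+1%:R :> R by [].
set u := Num.sqrt n%:R; set v := Num.sqrt n.+1%:R.
have v0 : 0 < v by rewrite sqrtr_gt0.
have u0 : 0 <= u by exact: sqrtr_ge0.
have u2 : u ^+ 2 = n%:R by rewrite sqr_sqrtr.
have v2 : v ^+ 2 = u ^+ 2 + 1 by rewrite sqr_sqrtr// u2 -natr1.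
have vV : v * v^-1 = 1 by rewrite divff// gt_eqF.
have vV0 : 0 < v^-1 by rewrite invr_gt0.
rewrite -(ler_pM2l v0) mulrDr vV; have : 0 <= (v - u) ^+ 2 by exact: sqr_ge0.
by rewrite sqrrB v2; nra.
Qed.

(** Each of the [n + 1] terms of the convolution is at least [s n ^+ 2]. *)
Lemma convolution_upper n : s n <= (Num.sqrt n.+1%:R)^-1.
Proof.
have n1 : 0 < n.+1%:R :> R by [].
rewrite -(@ler_pXn2r _ 2)// ?nnegrE ?invr_ge0//.
rewrite exprVn sqr_sqrtr// -div1r ler_pdivlMr// mulr_natr -(s_conv n).
rewrite -[n.+1 in leLHS]subn0 -sumr_const_nat; apply: ler_sum_nat => k /andP[_ kn].
by rewrite expr2 ler_pM//; apply: s_noninc => //; rewrite leq_subr.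
Qed.

(** The convolution at the odd index [2n + 1] is twice its first half, where the factor
    [s (2n + 1 - k)] is at most [s (n + 1)]. Hence [1 <= 2 * s (n + 1) * sum_(k <= n) s k], and the
    upper bound controls the sum. *)
Lemma convolution_lower n : (4 * Num.sqrt n.+1%:R)^-1 <= s n.
Proof.
have v0 k : 0 < Num.sqrt k.+1%:R :> R by rewrite sqrtr_gt0.
rewrite -div1r ler_pdivrMr ?mulr_gt0//.
case: n => [|n].
  have := s_conv 0; rewrite big_nat1 subn0 => s0.
  by have := s_ge0 0; rewrite sqrtr1; nra.
apply: (@le_trans _ _ (s n.+1 * (4 * Num.sqrt n.+1%:R))); last first.
  by rewrite ler_wpM2l// ler_wpM2l// ler_sqrt// ler_nat.
have half : \sum_(0 <= k < n.+1) s k * s (n.*2.+1 - k) =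
            \sum_(n.+1 <= k < n.*2.+2) s k * s (n.*2.+1 - k).
  rewrite [RHS]big_nat_rev /= -{2}[n.+1]add0n big_addn.
  have -> : (n.*2.+2 - n.+1 = n.+1)%N by lia.
  apply: eq_big_nat => k kn; rewrite mulrC; congr (s _ * s _); lia.
have := s_conv n.*2.+1; rewrite (@big_cat_nat _ _ _ n.+1)//=; last by lia.
rewrite -half -mulr2n => c1; rewrite -[leLHS]c1 -[leLHS]mulr_natl.
apply: (@le_trans _ _ (2 * \sum_(0 <= k < n.+1) (Num.sqrt k.+1%:R)^-1 * s n.+1)).
  rewrite ler_wpM2l//; apply: ler_sum_nat => k /andP[_ kn].
  by rewrite ler_pM// ?convolution_upper// s_noninc//; lia.
rewrite -mulr_suml; have := sum_inv_sqrt_le n.+1.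
set A := \sum_(_ <= _ < _) _; set v := Num.sqrt _ => Av.
by have := s_ge0 n.+1; nra.
Qed.

End self_convolution.

(** Each doubling of the range contributes at least 1/2. *)
Lemma harmonic_block (R : realType) (l J : nat) : (0 < l)%N ->
  (J%:R / 2 : R) <= \sum_(l <= a < 2 ^ J * l) (a.+1%:R)^-1.
Proof.
move=> l0; elim: J => [|J IH]; first by rewrite mul0r sumr_ge0.
have lJ : (l <= 2 ^ J * l)%N by rewrite leq_pmull// expn_gt0.
have JJ : (2 ^ J * l <= 2 ^ J.+1 * l)%N by rewrite leq_mul2r leq_exp2l ?leqnSn ?orbT.
rewrite (big_cat_nat lJ JJ)/= -natr1 mulrDl lerD//.
set b := (2 ^ J * l)%N; have b0 : (0 < b)%N by rewrite /b muln_gt0 expn_gt0 l0.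
have -> : (2 ^ J.+1 * l = b + b)%N by rewrite expnS /b; lia.
apply: (@le_trans _ _ (\sum_(b <= a < b + b) ((b + b)%:R)^-1)).
  rewrite sumr_const_nat addKn natrD -[leRHS]mulr_natl.
  have : 0 < b%:R :> R by rewrite ltr0n.
  by move=> bR; rewrite ler_pdivlMr ?addr_gt0//; lra.
apply: ler_sum_nat => a /andP[_ ab].
by rewrite lef_pV2 ?posrE ?ltr0n ?addn_gt0 ?b0// ler_nat.
Qed.

(** * Pairs of minima at distance one *)

Section pair_hits.
Context (R : realType) (nu : set R -> \bar R) (Q : probability (rseq R) R).
Hypothesis iidQ : iid_law nu Q.
Hypothesis nuN : forall A : set R, measurable A -> nu (-%R @^-1` A) = nu A.
Hypothesis noatom : forall a b, (a < b)%N -> pr Q [set x | bl x a b = 0] = 0.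
Variables (L A q : nat).
Hypothesis L_le_A : (L <= A)%N.
Let m := (4 * A)%N.
Hypothesis m_le_q : (m <= q)%N.
Local Notation stay := (stay Q).

(** The index [k] stands for [t], and [q + k'] for [t + 1]. The order [k' <= k] reflects that the
    first minimum is approached from the right and the second from the left. The bound [2 * A] keeps
    half of the block [[0, m[] free after the hit. *)
Definition pair_hit : set (rseq R) := [set x | exists k' k,
  ((k' <= k <= k' + L)%N /\ (k <= 2 * A)%N) /\ (Past q (q + k') x /\ Fut k m x)].

(* On [Fut k m], [(k', k)] is the first hit; but [D k' k] itself only looks at the
   increments before [q + k'] in one block and before [k] in the other. *)
Let D k' k : set (rseq R) := [set x | Past q (q + k') x /\ forall i' i,
  [&& i' <= i <= i' + L, i' <= k', i <= k & (i' + i < k' + k)]%N ->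
  ~ (Past q (q + i') x /\ Fut i k x)].

Let measurable_D k' k : measurable (D k' k).
Proof.
apply: measurable_and_set; first exact: measurable_Past.
do 2 (apply: measurable_forall => ?); apply: measurable_imply.
by apply: measurable_not; apply: measurable_and_set;
  [exact: measurable_Past|exact: measurable_Fut].
Qed.

Lemma measurable_pair_hit : measurable pair_hit.
Proof.
do 2 (apply: measurable_exists => ?); apply: measurable_conj.
by apply: measurable_and_set; [exact: measurable_Past|exact: measurable_Fut].
Qed.

Let determined_D k' k :
  determined (fun i => (q <= i < q + k') || (i < k))%N (D k' k).
Proof.
move=> x y xy [Px Dx]; split.
  by apply: determined_Past Px => i ik; apply: xy; rewrite ik.
move=> i' i ii [Py Fy]; apply: (Dx i' i ii); split.
  apply: determined_Past Py => l ll; apply/esym/xy.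
  by apply/orP; left; lia.
apply: determined_Fut Fy => l ll; apply/esym/xy.
by apply/orP; right; lia.
Qed.

(** If neither pair dominates the other, say [k' < i'] and [i < k], the crossed pair [(k', i)] is
    again a hit, because [k' < i' <= i < k <= k' + L], and it precedes [(k', k)]. *)
Let D_disjoint (x : rseq R) k' k i' i : (k' <= k <= k' + L)%N -> (i' <= i <= i' + L)%N ->
  (i <= k)%N -> D k' k x -> D i' i x -> Fut k m x -> Fut i m x -> (k <= m)%N ->
  (k', k) = (i', i).
Proof.
move=> kk ii ik [Pk Dk] [Pi Di] Fk Fi km.
have Fik n : (n <= m)%N -> Fut i n x by move=> nm j jn; apply: Fi; lia.
apply: contrapT => ne.
have [ltik|] := ltnP i k.
  have [ik'|ki'] := leqP i' k'.
    by apply: (Dk i' i); [lia|split => //; exact: Fik].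
  by apply: (Dk k' i); [lia|split => //; exact: Fik].
move=> ki; have {ik ki} eik : i = k by lia.
subst i; case: (ltngtP i' k') => [lt|lt|eq]; last by apply: ne; rewrite eq.
  by apply: (Dk i' k); [lia|split => //; exact: Fik].
by apply: (Di k' k); [lia|split => //; exact: Fik].
Qed.

(** Double counting of exact coincidences, that is of [j] with both [Past q (q + j)] and [Fut j m]:
    their expected number is the convolution, hence exactly 1. Each first hit, weighted by its
    probability, contributes at least the sum of [1/(32 (a + 1))] over the distances [a] to later
    coincidences. *)
Lemma pr_pair_hit : pr Q pair_hit * (\sum_(L <= a < A) (a.+1%:R)^-1) <= 32.
Proof.
have stay0 k : 0 <= stay k by exact: stay_ge0.
have stayD := @stay_nonincreasing _ Q.
have stayC := stay_convolution iidQ nuN noatom.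
pose r := [seq (k', k) | k' <- iota 0 (2 * A).+1, k <- iota 0 (2 * A).+1].
pose ok (p : nat * nat) := (p.1 <= p.2 <= p.1 + L)%N.
pose rr := [seq p <- r | ok p].
have rrP (p : nat * nat) : p \in rr -> [/\ (p.1 <= p.2)%N, (p.2 <= p.1 + L)%N & (p.2 <= 2 * A)%N].
  rewrite mem_filter /ok => /andP[/andP[p1 p2]] /allpairsP[[u v] [_ vK pE]].
  by move: vK p1 p2; rewrite pE mem_iota /= => vK p1 p2; split => //; lia.
have urr : uniq rr by rewrite filter_uniq// allpairs_uniq ?iota_uniq// => -[? ?] [? ?].
pose F p : set (rseq R) := D p.1 p.2 `&` Fut p.2 m.
have mF p : measurable (F p) by apply: measurableI => //; exact: measurable_Fut.
have up : pr Q pair_hit <= \sum_(p <- rr) pr Q (D p.1 p.2) * stay (m - p.2).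
  rewrite (eq_bigr (fun p => pr Q (F p))); last first.
    move=> p _; rewrite (pr_indep iidQ _ _ (@determined_D p.1 p.2) (@determined_Fut R p.2 m)).
    - by rewrite (pr_Fut iidQ).
    - exact: measurable_D.
    - exact: measurable_Fut.
    - by move=> i; move: m_le_q; lia.
  apply: pr_union_le => //; first exact: measurable_pair_hit.
  move=> x [k0' [k0 hit0]].
  (* The first hit minimises [k' + k]. An earlier pair visible at [k] would be a hit by [Fut_cat],
     contradicting minimality. *)
  pose H n := `[< exists k' k, (k' + k = n)%N /\
     ((k' <= k <= k' + L)%N /\ (k <= 2 * A)%N) /\ (Past q (q + k') x /\ Fut k m x) >].
  have exH : exists n, H n by exists (k0' + k0)%N; apply/asboolP; exists k0', k0.
  have [n /asboolP[k' [k [nE [[kk kK] [Pk Fk]]]]] nmin] := ex_minnP exH.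
  exists (k', k).
    rewrite mem_filter /ok /= kk /=; apply/allpairsP; exists (k', k).
    by split; rewrite // mem_iota /=; lia.
  split => //=; split => // i' i /and4P[ii ik' ik lt] [Pi Fi].
  have : (n <= i' + i)%N; last by lia.
  apply: nmin; apply/asboolP; exists i', i; split => //; split.
    by split => //; lia.
  by split => //; exact: Fut_cat Fi Fk.
(* First hit at [p] followed by a coincidence at [j]. The four conditions bear on disjoint sets of
   increments; the concatenation lemmas show that [p] is indeed a hit and [j] a coincidence. *)
pose E (p : nat * nat) j : set (rseq R) :=
  D p.1 p.2 `&` ((Past (q + p.1) (q + j) `&` Fut p.2 j) `&` Fut j m).
have mE p j : measurable (E p j).
  apply: measurableI => //; apply: measurableI; last exact: measurable_Fut.
  by apply: measurableI; [exact: measurable_Past|exact: measurable_Fut].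
(* A distance of at least [L] puts [j] after both members of [p]; a distance below [A] keeps [j]
   within the block, as [2 * A + A <= m]. *)
pose cd j (p : nat * nat) := (p.1 + L <= j < p.1 + A)%N.
have count j : \sum_(p <- rr | cd j p) pr Q (E p j) <= pr Q (Past q (q + j) `&` Fut j m).
  rewrite -big_filter; apply: pr_disjoint_le => //.
  - by apply: measurableI; [exact: measurable_Past|exact: measurable_Fut].
  - by rewrite filter_uniq.
  - move=> p x; rewrite mem_filter => /andP[pj /rrP[? ? ?]] [[Pp _] [[Pj Fj] Fm]]; split => //.
    by apply: (Past_cat _ Pp Pj); move: pj; rewrite /cd; lia.
  move=> [k' k] [i' i] x; rewrite mem_filter => /andP[cp /rrP[k1 k2 kK]].
  rewrite mem_filter => /andP[ci /rrP[i1 i2 iK]] [Dp [[_ Fp] Fm]] [Di [[_ Fi] _]].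
  rewrite /= in k1 k2 kK i1 i2 iK Dp Di Fp Fi.
  have Fkm : Fut k m x by apply: Fut_cat Fp Fm; move: cp; rewrite /cd /=; lia.
  have Fim : Fut i m x by apply: Fut_cat Fi Fm; move: ci; rewrite /cd /=; lia.
  have [ik|/ltnW ki] := leqP i k.
    by apply: (D_disjoint _ _ ik Dp Di Fkm Fim); rewrite ?k1 ?i1//; rewrite /m; lia.
  by apply/esym; apply: (D_disjoint _ _ ki Di Dp Fim Fkm); rewrite ?k1 ?i1//; rewrite /m; lia.
have total : \sum_(0 <= j < m.+1) pr Q (Past q (q + j) `&` Fut j m) = 1.
  rewrite -(stayC m); apply: eq_big_nat => j jm.
  rewrite (pr_indep iidQ _ _ (@determined_Past R q (q + j)) (@determined_Fut R j m)).
  - by rewrite (pr_Past iidQ nuN noatom) ?leq_addr// (pr_Fut iidQ) addKn.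
  - exact: measurable_Past.
  - exact: measurable_Fut.
  - by move=> i; lia.
(* The constant 32 comes from [4 sqrt(a + 1) * 4 sqrt(2a + 1) <= 32 (a + 1)]. The remaining factor
   [stay (m - j)] is at least [stay (m - p.2)] since [j] comes after [p.2]. *)
have low (p : nat * nat) : p \in rr -> pr Q (D p.1 p.2) * stay (m - p.2) *
     (\sum_(L <= a < A) (a.+1%:R)^-1 / 32) <= \sum_(0 <= j < m.+1 | cd j p) pr Q (E p j).
  move=> /rrP[p1 p2 pK].
  rewrite [leRHS](eq_bigl (fun j => (p.1 + L <= j) && (j < p.1 + A))%N)//.
  rewrite -[leRHS](@big_nat_widen _ _ _ 0 (p.1 + A) m.+1 (fun j => p.1 + L <= j)%N)/=; last first.
    by rewrite /m; lia.
  rewrite -[leRHS](@big_nat_widenl _ _ _ (p.1 + L) 0 (p.1 + A) xpredT)//=.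
  rewrite (addnC _ L) (addnC _ A) [leRHS]big_addn addnK mulr_sumr.
  apply: ler_sum_nat => a /andP[La aA].
  have -> : pr Q (E p (a + p.1)) =
      pr Q (D p.1 p.2) * (stay a * stay (a + p.1 - p.2) * stay (m - (a + p.1))).
    rewrite /E (pr_indep iidQ _ _ (@determined_D p.1 p.2)
      (determinedI (determinedI (@determined_Past R (q + p.1) (q + (a + p.1)))
      (@determined_Fut R p.2 (a + p.1))) (@determined_Fut R (a + p.1) m))).
    - rewrite (pr_indep iidQ _ _ (determinedI (@determined_Past R (q + p.1) (q + (a + p.1)))
        (@determined_Fut R p.2 (a + p.1))) (@determined_Fut R (a + p.1) m)).
      + rewrite (pr_indep iidQ _ _ (@determined_Past R (q + p.1) (q + (a + p.1)))
          (@determined_Fut R p.2 (a + p.1))).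
        * rewrite (pr_Past iidQ nuN noatom) ?(pr_Fut iidQ); last by lia.
          by congr (_ * (stay _ * _ * _)); lia.
        * exact: measurable_Past.
        * exact: measurable_Fut.
        * by move=> i; lia.
      + by apply: measurableI; [exact: measurable_Past|exact: measurable_Fut].
      + exact: measurable_Fut.
      + by move=> i /=; lia.
    - exact: measurable_D.
    - apply: measurableI; last exact: measurable_Fut.
      by apply: measurableI; [exact: measurable_Past|exact: measurable_Fut].
    - by move=> i /=; lia.
  rewrite -mulrA ler_wpM2l ?pr_ge0//.
  rewrite [X in X <= _]mulrC ler_pM//.
    apply: (@le_trans _ _ ((4 * Num.sqrt a.+1%:R)^-1 * (4 * Num.sqrt (a.*2).+1%:R)^-1)).
      have v0 k : 0 < Num.sqrt k.+1%:R :> R by rewrite sqrtr_gt0.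
      have sv : Num.sqrt (a.*2).+1%:R <= 2 * Num.sqrt a.+1%:R :> R.
        rewrite -(@ler_pXn2r _ 2)// ?nnegrE ?mulr_ge0 ?sqrtr_ge0//.
        rewrite exprMn !sqr_sqrtr// -natrX -natrM ler_nat; lia.
      rewrite -!invfM lef_pV2 ?posrE ?mulr_gt0//.
      have := v0 a; have := v0 a.*2; rewrite -[X in _ <= X * _](@sqr_sqrtr _ a.+1%:R)//.
      by move: sv; set u := Num.sqrt _; set v := Num.sqrt _ => *; nra.
    rewrite ler_pM ?invr_ge0 ?mulr_ge0 ?sqrtr_ge0// ?(convolution_lower stay0 stayD stayC)//.
    apply: (le_trans (convolution_lower stay0 stayD stayC _)).
    by apply: stayD; lia.
  by apply: stayD; lia.
have H32 : pr Q pair_hit * (\sum_(L <= a < A) (a.+1%:R)^-1 / 32) <= 1.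
  rewrite -[leRHS]total.
  apply: (@le_trans _ _ (\sum_(0 <= j < m.+1) \sum_(p <- rr | cd j p) pr Q (E p j)));
    last by apply: ler_sum => j _; exact: count.
  under [leRHS]eq_bigr do rewrite big_mkcond/=.
  rewrite exchange_big/=.
  have H0 : 0 <= \sum_(L <= a < A) (a.+1%:R)^-1 / 32 :> R.
    by rewrite sumr_ge0// => a _; rewrite divr_ge0// invr_ge0.
  apply: le_trans (ler_wpM2r H0 up) _; rewrite mulr_suml.
  rewrite big_seq [leRHS]big_seq; apply: ler_sum => p pr_.
  by apply: le_trans (low p pr_) _; rewrite big_mkcond.
move: H32; rewrite -mulr_suml mulrA ler_pdivrMr// mul1r.
exact.
Qed.

End pair_hits.

(** * Gaussian walks *)

Section gaussian_estimates.
Context (R : realType).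
Implicit Types s w y eta : R.
Notation mu := (@lebesgue_measure R).

Let ball w eta : set R := `[w - eta, w + eta]%classic.
Let ray y : set R := `]-oo, (- y)[%classic.

Let closed_ball_itv w eta : [set y : R | `|y - w| <= eta] = ball w eta.
Proof. by apply/seteqP; split => y; rewrite /ball /= in_itv/= ler_distl. Qed.

Let measure_closed_ball w eta : 0 <= eta ->
  mu (ball w eta) = (2 * eta)%:E.
Proof.
move=> eta0; rewrite /ball lebesgue_measure_itv/= lte_fin.
case: ltP => [_|le]; first by rewrite -EFinB; congr (_%:E); ring.
have -> : eta = 0 by apply/eqP; rewrite eq_le eta0 andbT; lra.
by rewrite mulr0.
Qed.

Let integral_ball_cst w eta r : 0 <= eta ->
  (\int[mu]_(y in ball w eta) r%:E = (r * (2 * eta))%R%:E)%E.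
Proof.
move=> eta0; rewrite integral_cst; last exact: measurable_itv.
by rewrite [X in (_ * X)%E = _](measure_closed_ball _ eta0).
Qed.

(** The density is at most [1/(2 s)], because [pi >= 2], on an interval of length [2 eta]. *)
Lemma normal_prob_ball_le s w eta : 0 < s -> 0 <= eta ->
  (normal_prob 0 s [set y : R | (`|y - w| <= eta)%R] <= (eta / s)%R%:E)%E.
Proof.
move=> s0 eta0; rewrite closed_ball_itv /normal_prob.
have s_ge0 := ltW s0; have s_neq0 : s != 0 by rewrite gt_eqF.
apply: (@le_trans _ _ (\int[mu]_(y in ball w eta) (normal_peak s)%:E)%E).
  apply: ge0_le_integral; rewrite ?/ball ?/ray //=.
  - by move=> x _; rewrite lee_fin normal_pdf_ge0.
  - by apply/measurable_EFinP/measurable_funTS; exact: measurable_normal_pdf.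
  - by move=> x _; rewrite lee_fin normal_pdf_ub.
rewrite integral_ball_cst// lee_fin.
have peak2 : normal_peak s <= (2 * s)^-1.
  rewrite /normal_peak lef_pV2 ?posrE ?mulr_gt0 ?sqrtr_gt0//; last first.
    by rewrite pmulrn_lgt0// mulr_gt0 ?exprn_gt0 ?pi_gt0.
  rewrite -(@ler_pXn2r _ 2)// ?nnegrE ?sqrtr_ge0 ?mulr_ge0//.
  rewrite sqr_sqrtr; last by rewrite mulrn_wge0// mulr_ge0 ?exprn_ge0 ?pi_ge0// ltW.
  have s2 : 0 < s ^+ 2 by rewrite exprn_gt0.
  by have := ler_wpM2l (ltW s2) (@pi_ge2 R); lra.
apply: le_trans (ler_wpM2r _ peak2) _; first by rewrite mulr_ge0.
by rewrite invfM mulrACA mulVf// mul1r mulrC.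
Qed.

(** The ball lies in [[- K s, K s]], where the density is at least [exp (- K^2/2) / (4 s)]. *)
Lemma normal_prob_ball_ge (K : R) : 0 <= K -> exists2 c : R, 0 < c &
  forall s w eta, 0 < s -> 0 <= eta -> `|w| + eta <= K * s ->
  ((c * eta / s)%R%:E <= normal_prob 0 s [set y : R | (`|y - w| <= eta)%R])%E.
Proof.
move=> K0; exists (expR (- (K ^+ 2 / 2)) / 2).
  by rewrite divr_gt0// expR_gt0.
move=> s w eta s0 eta0 wK; rewrite closed_ball_itv /normal_prob.
have s_ge0 := ltW s0; have s_neq0 : s != 0 by rewrite gt_eqF.
set e := expR _; have e0 : 0 <= e by exact: expR_ge0.
have peak4 : (4 * s)^-1 <= normal_peak s.
  rewrite /normal_peak lef_pV2 ?posrE ?mulr_gt0 ?sqrtr_gt0//; last first.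
    by rewrite pmulrn_lgt0// mulr_gt0 ?exprn_gt0 ?pi_gt0.
  rewrite -(@ler_pXn2r _ 2)// ?nnegrE ?sqrtr_ge0 ?mulr_ge0//.
  rewrite sqr_sqrtr; last by rewrite mulrn_wge0// mulr_ge0 ?exprn_ge0 ?pi_ge0// ltW.
  have s2 : 0 < s ^+ 2 by rewrite exprn_gt0.
  have pi4 : pi <= 4 :> R by have := @pihalf_lt2 R; lra.
  by have := ler_wpM2l (ltW s2) pi4; lra.
apply: (@le_trans _ _ (\int[mu]_(y in ball w eta) ((4 * s)^-1 * e)%R%:E)%E).
  rewrite integral_ball_cst// lee_fin.
  rewrite le_eqVlt; apply/orP; left; apply/eqP; field; exact: s_neq0.
apply: ge0_le_integral; rewrite ?/ball ?/ray //=.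
- by move=> x _; rewrite lee_fin mulr_ge0 ?invr_ge0 ?mulr_ge0.
- by apply/measurable_EFinP/measurable_funTS; exact: measurable_normal_pdf.
move=> x; rewrite in_itv/= => /andP[x1 x2]; rewrite lee_fin normal_pdfE//.
rewrite ler_pM ?invr_ge0 ?mulr_ge0//.
rewrite /normal_fun subr0 ler_expR mulNr lerN2.
rewrite -mulr_natr invfM mulrA ler_wpM2r// ler_pdivrMr ?exprn_gt0//.
rewrite -exprMn -[x ^+ 2]real_normK ?num_real// ler_pXn2r ?nnegrE ?mulr_ge0//.
apply: le_trans wK; rewrite ler_norml.
by have := ler_norm w; have := ler_norm (- w); rewrite normrN; lra.
Qed.

(** Comparison with the Gaussian of standard deviation [sqrt 2 * s]: beyond [y] the ratio of
    densities is [sqrt 2 * exp (- z^2/(4 s^2))], at most [2 * exp (- 8) <= 2/256], and the larger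
    Gaussian has mass at most 1. *)
Lemma normal_prob_lt_le s y : 0 < s -> 0 <= y -> 32 * s ^+ 2 <= y ^+ 2 ->
  (normal_prob 0 s [set z : R | (z < - y)%R] <= (128^-1)%R%:E)%E.
Proof.
move=> s0 y0 sy; rewrite /normal_prob.
have s_ge0 := ltW s0; have s_neq0 : s != 0 by rewrite gt_eqF.
pose t := Num.sqrt 2 * s.
have t0 : 0 < t by rewrite mulr_gt0// sqrtr_gt0.
have t_neq0 : t != 0 by rewrite gt_eqF.
have tE : t ^+ 2 = 2 * s ^+ 2 by rewrite /t exprMn sqr_sqrtr.
have mray : measurable (ray y) by exact: measurable_itv.
have -> : [set z : R | z < - y] = ray y.
  by apply/seteqP; split => z /=; rewrite /ray /=; rewrite in_itv.
apply: (@le_trans _ _ (\int[mu]_(z in ray y) (128^-1 * normal_pdf 0 t z)%R%:E)%E).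
  apply: ge0_le_integral; rewrite ?/ball ?/ray //=.
  - by move=> x _; rewrite lee_fin normal_pdf_ge0.
  - by apply/measurable_EFinP/measurable_funTS; exact: measurable_normal_pdf.
  - apply/measurable_EFinP; apply: measurable_funM => //.
    by apply: measurable_funTS; exact: measurable_normal_pdf.
  move=> z; rewrite in_itv/= => zy; rewrite lee_fin !normal_pdfE//.
  rewrite /normal_fun !subr0 tE.
  have -> : - z ^+ 2 / (s ^+ 2 *+ 2) = - (z ^+ 2 / (4 * s ^+ 2)) + - z ^+ 2 / ((2 * s ^+ 2) *+ 2).
    by field; exact: s_neq0.
  rewrite expRD mulrA [leRHS]mulrA ler_wpM2r ?expR_ge0//.
  have -> : normal_peak s = Num.sqrt 2 * normal_peak t.
    rewrite /normal_peak tE.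
    have -> : 2 * s ^+ 2 * pi *+ 2 = 2 * (s ^+ 2 * pi *+ 2) by ring.
    by rewrite [in RHS]sqrtrM// invfM mulrA divff ?mul1r// gt_eqF// sqrtr_gt0.
  rewrite mulrAC ler_wpM2r ?normal_peak_ge0//.
  have e8 : expR (- (z ^+ 2 / (4 * s ^+ 2))) <= 256^-1.
    apply: (@le_trans _ _ (expR (- 8))).
      rewrite ler_expR lerN2 ler_pdivlMr ?mulr_gt0 ?exprn_gt0//.
      by have : y ^+ 2 <= z ^+ 2; [nra|lra].
    rewrite expRN lef_pV2 ?posrE ?expR_gt0//.
    have -> : 8 = 8%:R * 1 :> R by rewrite mulr1.
    rewrite expRM_natl; apply: (@le_trans _ _ (2 ^+ 8)); first by rewrite -natrX ler_nat.
    rewrite lerXn2r ?nnegrE ?expR_ge0//.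
    by have := expR_ge1Dx (1 : R); lra.
  have r2 : Num.sqrt 2 <= 2 :> R.
    by rewrite -[leRHS]ger0_norm// -sqrtr_sqr ler_sqrt; lra.
  have r0 := sqrtr_ge0 (2 : R); have := expR_ge0 (- (z ^+ 2 / (4 * s ^+ 2))).
  move: e8 r2 r0; set u := expR _; set v := Num.sqrt _ => *.
  have : v * u <= 2 * 256^-1 by rewrite ler_pM.
  lra.
under eq_integral do rewrite EFinM.
rewrite ge0_integralZl_EFin//=; last 2 first.
- by move=> x _; rewrite lee_fin normal_pdf_ge0.
- by apply/measurable_EFinP/measurable_funTS; exact: measurable_normal_pdf.
rewrite -[leRHS]mule1 lee_pmul2l ?lte_fin//.
exact: (probability_le1 (normal_prob 0 t) mray).
Qed.

Lemma normal_prob_opp s (A : set R) : s != 0 -> measurable A ->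
  normal_prob 0 s (-%R @^-1` A) = normal_prob 0 s A.
Proof.
move=> s0 mA; rewrite /normal_prob normal_pdfE//.
pose f (x : measurableTypeR R) : \bar R := (normal_peak s * normal_fun 0 s x)%:E.
pose N := (-%R : measurableTypeR R -> measurableTypeR R).
have mN : measurable_fun setT N by exact: oppr_measurable.
have mf : measurable_fun A f.
  by apply/measurable_EFinP/measurable_funTS/measurable_funM => //; exact: measurable_normal_fun.
have f0 : {in A, forall x, (0 <= f x)%E}.
  by move=> x _; rewrite lee_fin mulr_ge0 ?normal_peak_ge0 ?normal_fun_ge0.
transitivity (\int[mu]_(x in N @^-1` A) (f \o N) x)%E.
  by apply: eq_integral => x _; rewrite /f /= /normal_fun !subr0 sqrrN.
rewrite -(ge0_integral_pushforward mN)//.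
by apply: eq_measure_integral => //= B mB _; exact: lebesgue_measureN.
Qed.

End gaussian_estimates.

(** The law of block sums is recorded separately: it is read off the Brownian increments over longer
    intervals, without convolving Gaussian laws. *)
Definition gaussian_walk (R : realType) (q : nat) (Q : probability (rseq R) R) :=
  iid_law (normal_prob 0 (Num.sqrt (q%:R)^-1)) Q /\
  forall a b, (a < b)%N -> forall A : set R, measurable A ->
    Q [set x | A (bl x a b)] = normal_prob 0 (Num.sqrt ((b - a)%:R / q%:R)) A.

(** * Gaussian walks that stay on one side *)

Section gaussian_walk_estimates.
Context (R : realType) (q : nat) (Q : probability (rseq R) R).
Hypothesis q_gt0 : (0 < q)%N.
Hypothesis gQ : gaussian_walk q Q.
Local Notation stay := (stay Q).

Let iidQ := gQ.1.
Let sd k : R := Num.sqrt (k%:R / q%:R).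

Let qR_gt0 : 0 < q%:R :> R. Proof. by rewrite ltr0n. Qed.

Let sd_gt0 k : (0 < k)%N -> 0 < sd k.
Proof. by move=> k0; rewrite sqrtr_gt0 divr_gt0// ltr0n. Qed.

Let sd2 k : sd k ^+ 2 = k%:R / q%:R.
Proof. by rewrite sqr_sqrtr// divr_ge0. Qed.

Lemma gaussian_step_opp (A : set R) : measurable A ->
  normal_prob 0 (Num.sqrt (q%:R)^-1) (-%R @^-1` A) = normal_prob 0 (Num.sqrt (q%:R)^-1) A.
Proof.
by move=> mA; apply: normal_prob_opp => //; rewrite gt_eqF// sqrtr_gt0 invr_gt0.
Qed.

Let pr_bl a b (A : set R) : (a < b)%N -> measurable A ->
  (pr Q [set x | A (bl x a b)])%:E = normal_prob 0 (sd (b - a)) A.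
Proof.
move=> ab mA; rewrite -(gQ.2 _ _ ab _ mA) prE//.
rewrite (_ : [set x | _] = (fun x => bl x a b) @^-1` A)//.
by rewrite -[X in measurable X]setTI; exact: measurable_bl.
Qed.

Let measurable_ball w eta : measurable [set y : R | `|y - w| <= eta].
Proof.
apply: measurable_le_set => //; apply: measurableT_comp => //.
exact: measurable_funB.
Qed.

Lemma pr_bl_ball_le a b w eta : (a < b)%N -> 0 <= eta ->
  pr Q [set x | `|bl x a b - w| <= eta] <= eta / Num.sqrt ((b - a)%:R / q%:R).
Proof.
move=> ab eta0; rewrite -lee_fin (pr_bl ab (measurable_ball w eta)).
by apply: normal_prob_ball_le => //; rewrite sd_gt0// subn_gt0.
Qed.

Lemma gaussian_noatom a b : (a < b)%N -> pr Q [set x | bl x a b = 0] = 0.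
Proof.
move=> ab; apply/eqP; rewrite eq_le pr_ge0 andbT.
have := pr_bl_ball_le 0 ab (lexx 0); rewrite mul0r; congr (pr Q _ <= _).
by apply/seteqP; split => x /=; rewrite subr0 normr_le0 => /eqP.
Qed.

Let noatom := gaussian_noatom.
Let nuN := gaussian_step_opp.

Lemma gaussian_stay_upper n : stay n <= (Num.sqrt n.+1%:R)^-1.
Proof.
apply: convolution_upper; [exact: stay_ge0|exact: stay_nonincreasing|].
exact: stay_convolution iidQ nuN noatom.
Qed.

Lemma gaussian_stay_lower n : (4 * Num.sqrt n.+1%:R)^-1 <= stay n.
Proof.
apply: convolution_lower; [exact: stay_ge0|exact: stay_nonincreasing|].
exact: stay_convolution iidQ nuN noatom.
Qed.

Lemma pr_bl_lt_le a b y : (a <= b)%N -> 0 <= y -> 32 * ((b - a)%:R / q%:R) <= y ^+ 2 ->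
  pr Q [set x | bl x a b < - y] <= 128^-1.
Proof.
rewrite leq_eqVlt => /predU1P[<-|ab] y0 hy.
  have -> : [set x : rseq R | bl x a a < - y] = set0.
    by apply/seteqP; split => // x /=; rewrite bl_nil oppr_gt0 ltNge y0.
  by rewrite /pr measure0 /= invr_ge0.
rewrite -lee_fin (pr_bl ab (A := [set z | z < - y])).
  by apply: normal_prob_lt_le; rewrite ?sd2// sd_gt0// subn_gt0.
exact: measurable_lt_set.
Qed.

Let measurable_blP a b (A : set R) : measurable A ->
  measurable [set x : rseq R | A (bl x a b)].
Proof.
move=> mA; rewrite (_ : [set x | _] = (fun x => bl x a b) @^-1` A)//.
by rewrite -[X in measurable X]setTI; exact: measurable_bl.
Qed.

Let determined_blP a b (A : set R) :
  determined (fun i => a <= i < b)%N [set x : rseq R | A (bl x a b)].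
Proof. by move=> x y xy /=; rewrite (eq_bl xy). Qed.

Lemma pr_bl_le0_ge a b : (a <= b)%N -> 2^-1 <= pr Q [set x | bl x a b <= 0].
Proof.
rewrite leq_eqVlt => /predU1P[<-|ab].
  have -> : [set x : rseq R | bl x a a <= 0] = setT.
    by apply/seteqP; split => // x _ /=; rewrite bl_nil.
  by rewrite pr_setT; lra.
have mle : measurable [set z : R | z <= 0] by exact: measurable_le_set.
have mge : measurable [set z : R | 0 <= z] by exact: measurable_le_set.
have opp : pr Q [set x | 0 <= bl x a b] = pr Q [set x | bl x a b <= 0].
  apply: EFin_inj; rewrite !(pr_bl ab (A := [set z | 0 <= z]), pr_bl ab (A := [set z | z <= 0]))//.
  rewrite -(normal_prob_opp (s := sd (b - a)))//.
    by congr (normal_prob _ _ _); apply/seteqP; split => z /=; rewrite oppr_ge0.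
  by rewrite gt_eqF// sd_gt0// subn_gt0.
pose A (i : bool) : set (rseq R) := if i then [set x | bl x a b <= 0] else [set x | 0 <= bl x a b].
have mA i : measurable (A i).
  by rewrite /A; case: i; [exact: (@measurable_blP _ _ [set z | z <= 0])
                        |exact: (@measurable_blP _ _ [set z | 0 <= z])].
have := @pr_union_le _ _ _ Q _ [:: true; false] A setT measurableT mA.
rewrite pr_setT !big_cons big_nil addr0 /= opp => h.
suff : 1 <= pr Q [set x | bl x a b <= 0] + pr Q [set x | bl x a b <= 0] by lra.
by apply: h => x _; have [h|h] := leP (bl x a b) 0; [exists true|exists false => //=; exact: ltW].
Qed.

(** After the first passage below [- y], the independent remaining increment is nonpositive with
    probability at least 1/2. *)
Lemma levy_maximal n y :
  pr Q [set x | exists j, (j <= n)%N /\ bl x 0 j < - y] <=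
  2 * pr Q [set x | bl x 0 n < - y].
Proof.
pose D k : set (rseq R) := [set x | bl x 0 k < - y /\ forall i, (i < k)%N -> ~ bl x 0 i < - y].
have mlt k : measurable [set x : rseq R | bl x 0 k < - y].
  by apply: (@measurable_blP _ _ [set z | z < - y]); exact: measurable_lt_set.
have mD k : measurable (D k).
  apply: measurable_and_set; first exact: mlt.
  apply: (@measurable_forall _ (rseq R) (fun i => [set x | (i < k)%N -> ~ bl x 0 i < - y])) => i.
  by apply: (@measurable_imply _ (rseq R)); apply: measurable_not; exact: mlt.
have dD k : determined (fun i => i < k)%N (D k).
  move=> x z xz [Dx nx]; split.
    by rewrite -(@eq_bl _ x)// => i /andP[_]; exact: xz.
  move=> i ik; rewrite -(@eq_bl _ x); first exact: nx.
  by move=> j /andP[_ ji]; apply: xz; rewrite (ltn_trans ji).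
pose le0 k : set (rseq R) := [set x | bl x k n <= 0].
have mle0 k : measurable (le0 k).
  by apply: (@measurable_blP _ _ [set z | z <= 0]); exact: measurable_le_set.
apply: (@le_trans _ _ (\sum_(k <- iota 0 n.+1) pr Q (D k))).
  apply: pr_union_le => //.
    apply: (@measurable_exists _ (rseq R) (fun j => [set x | (j <= n)%N /\ bl x 0 j < - y])) => j.
    by apply: (@measurable_conj _ (rseq R)); exact: mlt.
  move=> x [j [jn xj]].
  have exb : exists j, bl x 0 j < - y by exists j.
  have [k xk kmin] := ex_minnP exb; exists k.
    by rewrite mem_iota /= ltnS (leq_trans (kmin _ xj)).
  by split => // i ik /kmin; rewrite leqNgt ik.
have half k : (k <= n)%N -> pr Q (D k) <= 2 * pr Q (D k `&` le0 k).
  move=> kn; rewrite (pr_indep iidQ (mD k) (mle0 k) (@dD k) (@determined_blP k n [set z | z <= 0])).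
    by have := pr_bl_le0_ge kn; have := pr_ge0 Q (D k); rewrite -/(le0 k); nra.
  by move=> i; lia.
apply: (@le_trans _ _ (\sum_(k <- iota 0 n.+1) 2 * pr Q (D k `&` le0 k))).
  rewrite big_seq [leRHS]big_seq; apply: ler_sum => k; rewrite mem_iota => /andP[_ kn].
  by rewrite half.
rewrite -mulr_sumr ler_wpM2l//; apply: pr_disjoint_le => //.
- by move=> k; exact: measurableI.
- exact: iota_uniq.
- move=> k x; rewrite mem_iota => /andP[_ kn] [[xk _] xkn].
  rewrite /= (@bl_cat _ _ 0 k n)//; move: xk xkn; rewrite /le0 /=; lra.
move=> i j x _ _ [[xi ni] _] [[xj nj] _].
by case: (ltngtP i j) => // [/nj|/ni].
Qed.

Let far n y := pr Q (Fut 0 n `&` [set x | y < bl x 0 n]).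

Let mgt a b y : measurable [set x : rseq R | y < bl x a b].
Proof.
by apply: (@measurable_blP _ _ [set z | y < z]); exact: measurable_lt_set.
Qed.

Let mFutgt a b y : measurable (Fut a b `&` [set x : rseq R | y < bl x a b]).
Proof. by apply: measurableI => //; exact: measurable_Fut. Qed.

Let dgt a b y : determined (fun i => a <= i < b)%N [set x : rseq R | y < bl x a b].
Proof. exact: (@determined_blP a b [set z | y < z]). Qed.

(** From a height above [2 y], the next [k - n] steps drop below [- y] with probability at most
    2/128. Otherwise the walk remains nonnegative and ends above [y]. *)
Let far_extend n k y : (n <= k)%N -> 0 <= y -> 32 * ((k - n)%:R / q%:R) <= y ^+ 2 ->
  far n (2 * y) <= 2 * far k y.
Proof.
move=> nk y0 hy.
pose G : set (rseq R) := [set x | exists j, (j <= k - n)%N /\ bl x 0 j < - y].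
have mG : measurable G.
  apply: (@measurable_exists _ (rseq R) (fun j => [set x | (j <= k - n)%N /\ bl x 0 j < - y])) => j.
  apply: (@measurable_conj _ (rseq R)).
  by apply: (@measurable_blP _ _ [set z | z < - y]); exact: measurable_lt_set.
pose H : set (rseq R) := [set x | (~` G) (fun i => x (n + i)%N)].
have mH : measurable H.
  apply: (@measurable_relabel R (addn n) (fun _ => id) (~` G)) => //.
  exact: measurableC.
have prH : 2^-1 <= pr Q H.
  rewrite /H (pr_shift iidQ)//; last exact: measurableC.
  have := levy_maximal (k - n) y; rewrite -/G => levyG.
  have prC : pr Q (~` G) = 1 - pr Q G.
    by apply: EFin_inj; rewrite -prE; [rewrite probability_setC// EFinB prE|exact: measurableC].
  have h1 := @pr_bl_lt_le 0 (k - n) y (leq0n _) y0.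
  by move: h1; rewrite subn0 => /(_ hy) h1; lra.
have dH : determined (fun i => n <= i < k)%N H.
  move=> x z xz Hx [j [jk xj]]; apply: Hx; exists j; split => //.
  rewrite (@eq_bl _ _ (fun i => z (n + i)%N))// => i /andP[_ ij].
  by apply: xz; lia.
apply: (@le_trans _ _ (2 * pr Q ((Fut 0 n `&` [set x | 2 * y < bl x 0 n]) `&` H))).
  rewrite (pr_indep iidQ (mFutgt 0 n (2 * y)) mH
    (determinedI (@determined_Fut R 0 n) (@dgt 0 n (2 * y))) dH).
    by have := pr_ge0 Q (Fut 0 n `&` [set x | 2 * y < bl x 0 n]); rewrite -/(far n (2 * y)); nra.
  by move=> i /=; lia.
rewrite ler_wpM2l//; apply: le_pr => //; first exact: measurableI.
move=> x [[Fx gx] Hx].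
have {}Hx j : (n <= j <= k)%N -> - y <= bl x n j.
  move=> /andP[nj jk]; rewrite leNgt; apply/negP => xj; apply: Hx.
  exists (j - n)%N; split; first lia.
  by rewrite bl_shift addn0 subnKC.
split => [j /andP[_ jk]|].
  have [jn|nj] := leqP j n; first by apply: Fx.
  rewrite (bl_cat _ (leq0n n) (ltnW nj)); have := Hx j; rewrite (ltnW nj) jk => /(_ isT).
  by move: gx => /=; lra.
rewrite /= (bl_cat _ (leq0n n) nk); have := Hx k; rewrite nk leqnn => /(_ isT).
by move: gx => /=; lra.
Qed.

(** The decomposition at the first minimum [N - k], restricted to paths that end more than [y] above
    it. These disjoint events all require a final block sum above [y], which by reversal and the
    maximal inequality has probability at most 2/128. *)
Let far_sum N y : 0 <= y -> 32 * (N%:R / q%:R) <= y ^+ 2 ->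
  \sum_(0 <= k < N.+1) stay (N - k) * far k y <= 64^-1.
Proof.
move=> y0 hy; pose G : set (rseq R) := [set x | exists j, (j <= N)%N /\ bl x 0 j < - y].
have mG : measurable G.
  apply: (@measurable_exists _ (rseq R) (fun j => [set x | (j <= N)%N /\ bl x 0 j < - y])) => j.
  apply: (@measurable_conj _ (rseq R)).
  by apply: (@measurable_blP _ _ [set z | z < - y]); exact: measurable_lt_set.
pose E k : set (rseq R) := Past 0 (N - k) `&` (Fut (N - k) N `&` [set x | y < bl x (N - k) N]).
have mE k : measurable (E k) by apply: measurableI => //; exact: measurable_Past.
pose G' : set (rseq R) := [set x | exists j, (j <= N)%N /\ y < bl x j N].
have mG' : measurable G'.
  apply: (@measurable_exists _ (rseq R) (fun j => [set x | (j <= N)%N /\ y < bl x j N])) => j.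
  by apply: (@measurable_conj _ (rseq R)); exact: mgt.
have prE' k : (k <= N)%N -> stay (N - k) * far k y = pr Q (E k).
  move=> kN; rewrite (pr_indep iidQ (measurable_Past _ _) (mFutgt _ _ _)
    (@determined_Past R 0 (N - k)) (determinedI (@determined_Fut R (N - k) N) (@dgt (N - k) N y))).
    rewrite (pr_Past iidQ nuN noatom)// subn0; congr (_ * _).
    rewrite /far -[LHS](pr_shift iidQ (N - k)) ?mFutgt//; congr (pr Q _).
    apply/seteqP; split => x /= [Fx gx]; split.
    - move=> j /andP[j1 j2]; have := Fx (j - (N - k))%N; rewrite bl_shift addn0 subnKC//; apply; lia.
    - by move: gx; rewrite bl_shift addn0 subnK.
    - by move=> j /andP[j1 j2]; rewrite bl_shift addn0; apply: Fx; lia.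
    - by rewrite bl_shift addn0 subnK.
  by move=> i /=; lia.
rewrite (eq_big_nat _ _ (F2 := fun k => pr Q (E k))); last by move=> k kN; exact: prE'.
apply: (@le_trans _ _ (pr Q G')).
  apply: pr_disjoint_le => //; first exact: iota_uniq.
    by move=> k x; rewrite mem_index_iota => kN [_ [_ gx]]; exists (N - k)%N; split => //; lia.
  suff H i j (x : rseq R) : (i < j)%N -> (j <= N)%N -> E i x -> E j x -> False.
    move=> i j x; rewrite !mem_index_iota => /= iN jN Ei Ej.
    by case: (ltngtP i j) => // ij; [case: (H i j x)|case: (H j i x)].
  move=> ij jN [Pi _] [_ [Fj _]].
  have := Pi (N - j)%N; have := Fj (N - i)%N => h1 h2.
  have : 0 <= bl x (N - j) (N - i) by apply: h1; lia.
  by rewrite leNgt h2//; lia.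
have -> : pr Q G' = pr Q G.
  rewrite -[RHS](pr_reverse iidQ nuN N)//; congr (pr Q _).
  apply/seteqP; split => x /= [j [jN h]].
    exists (N - j)%N; split; first lia.
    by rewrite bl_reverse ?leq_subr// subKn// ltrN2.
  exists (N - j)%N; split; first lia.
  by move: h; rewrite bl_reverse// ltrN2.
have h1 := @pr_bl_lt_le 0 N y (leq0n _) y0; rewrite subn0 in h1.
by have := levy_maximal N y; have := h1 hy; rewrite -/G; lra.
Qed.

(** [far_extend] bounds [far k] from below by half of the left side for all [k] in [[n, 2n]]. Since
    [stay (2n - k)] is at least [1/(4 v)] with [v^2 = n + 1], those terms of [far_sum] add up to at
    least [v/8] times the left side, hence the result. The bound is half of the lower bound for
    [stay n]. *)
Let far_le n : far n (16 * sd n) <= (8 * Num.sqrt n.+1%:R)^-1.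
Proof.
have y0 : 0 <= 8 * sd n by rewrite mulr_ge0// sqrtr_ge0.
have nq : 0 <= n%:R / q%:R :> R by rewrite divr_ge0.
have -> : 16 * sd n = 2 * (8 * sd n) by ring.
have ext k : (n <= k < n.*2.+1)%N -> far n (2 * (8 * sd n)) <= 2 * far k (8 * sd n).
  move=> /andP[nk kn]; apply: far_extend => //; rewrite exprMn sd2.
  have : (k - n)%:R / q%:R <= n%:R / q%:R :> R.
    by rewrite ler_pM2r ?invr_gt0// ler_nat; lia.
  by move: nq; lra.
have sum64 := @far_sum n.*2 (8 * sd n) y0.
have {sum64} : \sum_(0 <= k < n.*2.+1) stay (n.*2 - k) * far k (8 * sd n) <= 64^-1.
  by apply: sum64; rewrite exprMn sd2 -mul2n natrM; lra.
have far0 k y : 0 <= far k y by exact: pr_ge0.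
have st0 k : 0 <= stay k by exact: stay_ge0.
set F := far n _ in ext *; set v := Num.sqrt n.+1%:R.
have v0 : 0 < v by rewrite sqrtr_gt0.
have vv : v * v = n.+1%:R by rewrite -expr2 sqr_sqrtr.
rewrite (@big_cat_nat _ _ _ n)/=; [|lia|lia].
have : 0 <= \sum_(0 <= i < n) stay (n.*2 - i) * far i (8 * sd n).
  by apply: sumr_ge0 => i _; rewrite mulr_ge0.
have : v / 8 * F <= \sum_(n <= i < n.*2.+1) stay (n.*2 - i) * far i (8 * sd n).
  apply: (@le_trans _ _ (\sum_(n <= i < n.*2.+1) (4 * v)^-1 * (F / 2))).
    rewrite sumr_const_nat (_ : (n.*2.+1 - n = n.+1)%N); last by lia.
    rewrite -[leRHS]mulr_natr -vv le_eqVlt; apply/orP; left; apply/eqP; field.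
    by rewrite gt_eqF.
  apply: ler_sum_nat => i /andP[ni i2]; rewrite ler_pM ?invr_ge0 ?mulr_ge0//; first exact: ltW.
  - exact: far0.
  - apply: (le_trans (gaussian_stay_lower n)); apply: stay_nonincreasing; lia.
  - by have := ext i; rewrite ni i2 => /(_ isT); lra.
move=> h1 h2 h3; have h4 : v / 8 * F <= 64^-1 by lra.
by rewrite -div1r ler_pdivlMr ?mulr_gt0//; nra.
Qed.

(** What remains of [stay n >= 1/(4 v)] once the reversed [far] event, at most [1/(8 v)], is
    removed. It keeps the displacement within 16 standard deviations, where a Gaussian density is
    still bounded below. *)
Lemma pr_Past_near a n :
  (8 * Num.sqrt n.+1%:R)^-1 <=
  pr Q (Past a (a + n) `&` [set x | - (16 * Num.sqrt (n%:R / q%:R)) <= bl x a (a + n)]).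
Proof.
set y := 16 * _.
have mle : measurable [set x : rseq R | - y <= bl x a (a + n)].
  by apply: (@measurable_blP _ _ [set z | - y <= z]); exact: measurable_le_set.
have mlt b c : measurable [set x : rseq R | bl x b c < - y].
  by apply: (@measurable_blP _ _ [set z | z < - y]); exact: measurable_lt_set.
have mPl b c : measurable (Past b c `&` [set x : rseq R | bl x b c < - y]).
  by apply: measurableI => //; exact: measurable_Past.
have rev : pr Q (Past a (a + n) `&` [set x | bl x a (a + n) < - y]) <= far n y.
  have -> : far n y = pr Q [set x | (Fut 0 n `&` [set x | y < bl x 0 n])
      (fun i => - (x (a + reflect_index n i)%N))].
    rewrite /far -[LHS](pr_reverse iidQ nuN n)// -[LHS](pr_shift iidQ a)//.
    by apply: (@measurable_relabel R (reflect_index n) (fun _ => -%R)) => // ?; exact: oppr_measurable.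
  apply: le_pr => //.
    by apply: (@measurable_relabel R (addn a \o reflect_index n) (fun _ => -%R)) => //.
  move=> x [Px xy].
  have blE j : (j <= n)%N -> bl (fun i => - (x (a + reflect_index n i)%N)) 0 j = - bl x (a + (n - j)) (a + n).
    by move=> jn; rewrite (bl_reverse (fun i => x (a + i)%N))// bl_shift.
  split => [j /andP[_ jn]|].
    rewrite blE// oppr_ge0; case: (posnP j) => [->|j0]; first by rewrite subn0 bl_nil.
    by apply/ltW/Px; lia.
  by rewrite /= blE// subnn addn0 ltrNr; exact: xy.
have split_Past : stay n <= pr Q (Past a (a + n) `&` [set x | - y <= bl x a (a + n)]) +
    pr Q (Past a (a + n) `&` [set x | bl x a (a + n) < - y]).
  have <- : pr Q (Past a (a + n)) = stay n.
    by rewrite (pr_Past iidQ nuN noatom) ?leq_addr// addKn.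
  pose E (b : bool) : set (rseq R) := if b then Past a (a + n) `&` [set x | - y <= bl x a (a + n)]
    else Past a (a + n) `&` [set x | bl x a (a + n) < - y].
  have := @pr_union_le _ _ _ Q _ [:: true; false] E (Past a (a + n)) (measurable_Past _ _).
  rewrite !big_cons big_nil addr0; apply.
    by case; rewrite /E //; apply: measurableI => //; exact: measurable_Past.
  by move=> x Px; have [h|h] := leP (- y) (bl x a (a + n)); [exists true|exists false].
have := far_le n; have := gaussian_stay_lower n.
have v0 : 0 < Num.sqrt n.+1%:R :> R by rewrite sqrtr_gt0.
have -> : (4 * Num.sqrt n.+1%:R)^-1 = 2 * (8 * Num.sqrt n.+1%:R)^-1 :> R.
  by field; rewrite gt_eqF.
by move: rev split_Past; rewrite -/(sd n) -/y; lra.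
Qed.

End gaussian_walk_estimates.

(** * Minima with a prescribed increment *)

(** All indices [b] with [S b x] lie among the 9 integers following the smallest one, itself
    included. *)
Lemma sum_indic_close (R : realType) (T : Type) (S : nat -> set T) (G : set T) (x : T) N :
  (forall b, S b x -> G x) -> (forall b b', S b x -> S b' x -> (b <= b' + 8)%N) ->
  \sum_(b <- iota 0 N) \1_(S b) x <= 9 * \1_G x :> R.
Proof.
move=> SG close; have [[b0 Sb0]|nS] := pselect (exists b, S b x); last first.
  rewrite big1 ?mulr_ge0// => b _; rewrite indicE memNset// => Sb.
  by apply: nS; exists b.
rewrite [\1_G x]indicE mem_set ?mulr1; last exact: SG Sb0.
have exS : exists b, `[< S b x >] by exists b0; apply/asboolP.
have [b /asboolP Sb bmin] := ex_minnP exS.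
have -> : \sum_(b <- iota 0 N) \1_(S b) x = (size [seq b <- iota 0 N | x \in S b])%:R :> R.
  by rewrite size_filter -sum1_count natr_sum [RHS]big_mkcond /=; apply: eq_bigr => i _; rewrite indicE; case: (_ \in _).
rewrite ler_nat -(size_iota b 9); apply: uniq_leq_size.
  by rewrite filter_uniq// iota_uniq.
move=> i; rewrite mem_filter mem_iota => /andP[/set_mem Si _].
have := close _ _ Si Sb; have := bmin i; rewrite asboolT// => /(_ isT); rewrite mem_iota; lia.
Qed.

Section bridge_hits.
Context (R : realType) (q : nat) (Q : probability (rseq R) R).
Hypothesis q_gt0 : (0 < q)%N.
Hypothesis gQ : gaussian_walk q Q.
Local Notation stay := (stay Q).
Variables (l A : nat).
Hypothesis l_gt0 : (0 < l)%N.
Hypothesis A_gt0 : (0 < A)%N.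
Let m := (4 * A)%N.
Hypothesis m_lt_q : (2 * m <= q)%N.
Let eta : R := Num.sqrt l%:R / Num.sqrt q%:R.

Let iidQ := gQ.1.
Let nuN := @gaussian_step_opp R q q_gt0.
Let noatom := gaussian_noatom q_gt0 gQ.

(** The sum [bl x q (q + k) - bl x 0 k + bl x 0 q] is the increment of the walk from [k] to [q + k].
    The tolerance [eta] is the standard deviation of [l] steps. The last condition, with [K], makes
    finitely many values of [bl x 0 q], up to [eta], enough. *)
Definition bridge_hit (lambda K : R) : set (rseq R) := [set x |
  (exists k, (k <= 2 * A)%N /\ (Past q (q + k) x /\
     `|bl x q (q + k) - bl x 0 k + bl x 0 q - lambda| <= eta)) /\
  `|bl x 0 q - lambda| <= K].

Let Z (x : rseq R) k : R := bl x q (q + k) - bl x 0 k.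

Let Hit (c : R) k : set (rseq R) := [set x | Past q (q + k) x /\ `|Z x k + c| <= 2 * eta].

Let qR_gt0 : 0 < q%:R :> R. Proof. by rewrite ltr0n. Qed.
Let sq_gt0 : 0 < Num.sqrt q%:R :> R. Proof. by rewrite sqrtr_gt0. Qed.
Let sl_gt0 : 0 < Num.sqrt l%:R :> R. Proof. by rewrite sqrtr_gt0 ltr0n. Qed.
Let eta_gt0 : 0 < eta. Proof. exact: divr_gt0. Qed.

Let measurable_near (f : rseq R -> R) (c t : R) : measurable_fun setT f ->
  measurable [set x | `|f x + c| <= t].
Proof.
move=> mf; apply: (@measurable_le_set _ (rseq R)) => //; apply: measurableT_comp => //.
exact: measurable_funD.
Qed.

Let measurable_Z k : measurable_fun setT (fun x => Z x k).
Proof. by apply: measurable_funB; exact: measurable_bl. Qed.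

Lemma measurable_bridge_hit (lambda K : R) : measurable (bridge_hit lambda K).
Proof.
apply: measurable_and_set.
  apply: (@measurable_exists _ (rseq R) (fun k => [set x | (k <= 2 * A)%N /\ (Past q (q + k) x /\
     `|bl x q (q + k) - bl x 0 k + bl x 0 q - lambda| <= eta)])) => k.
  apply: (@measurable_conj _ (rseq R)); apply: measurable_and_set; first exact: measurable_Past.
  apply: (@measurable_near (fun x => Z x k + bl x 0 q) (- lambda)).
  by apply: measurable_funD => //; exact: measurable_bl.
by apply: (@measurable_near (fun x => bl x 0 q) (- lambda)); exact: measurable_bl.
Qed.

Let measurable_Hit c k : measurable (Hit c k).
Proof.
apply: measurable_and_set; first exact: measurable_Past.
exact: (measurable_near _ _ (measurable_Z k)).
Qed.

Let determined_Hit c k k' : (k <= k')%N ->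
  determined (fun i => (q <= i < q + k') || (i < k'))%N (Hit c k).
Proof.
move=> kk x y xy [Px Zx]; split.
  by apply: determined_Past Px => i ik; apply: xy; lia.
move: Zx; rewrite /Z (@eq_bl _ x y q); last by move=> i ik; apply: xy; lia.
by rewrite (@eq_bl _ x y 0)// => i ik; apply: xy; lia.
Qed.

(** What turns a hit at [k] into a near hit at [k + a]: the minimum is renewed, and the
    displacements in the two blocks almost cancel. *)
Let V k a : set (rseq R) := Past (q + k) (q + k + a) `&`
  [set x | `|bl x (q + k) (q + k + a) - bl x k (k + a) + 0| <= 2 * eta].

Let measurable_V k a : measurable (V k a).
Proof.
apply: measurableI; first exact: measurable_Past.
by apply: measurable_near; apply: measurable_funB; exact: measurable_bl.
Qed.

Let pr_V k a : pr Q (V k a) = pr Q (V 0 a).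
Proof.
rewrite -[RHS](pr_shift iidQ k)//; congr (pr Q _).
have E (x : rseq R) : V 0 a (fun i => x (k + i)%N) <-> V k a x.
  rewrite /V /setI /= !bl_shift !addn0 add0n (addnC q k) (addnA k).
  split=> -[Px ->]; split => // j ja.
    have := Px (j - k)%N; rewrite bl_shift (addnA k) subnKC; last lia.
    by apply; lia.
  by rewrite bl_shift (addnA k); apply: Px; lia.
by apply/seteqP; split => x /= /E.
Qed.

(* [bl x 0 q] depends on the increments of the first block, so it is replaced by the
   constants [c] of a grid of step [eta]; the independent increment over [m, q[
   provides the factor [eta] paying for the number of constants. *)
Let fixed_hit c : set (rseq R) := [set x | exists k, (k <= 2 * A)%N /\ Hit c k x].

Let measurable_fixed_hit c : measurable (fixed_hit c).
Proof.
apply: (@measurable_exists _ (rseq R) (fun k => [set x | (k <= 2 * A)%N /\ Hit c k x])) => k.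
exact: (@measurable_conj _ (rseq R)).
Qed.

(** The tolerance adds [2 * eta] at the first hit and [2 * eta] from [V]. *)
Let G c j : set (rseq R) := [set x | Past q (q + j) x /\ `|Z x j + c| <= 4 * eta].

Let measurable_G c j : measurable (G c j).
Proof.
apply: measurable_and_set; first exact: measurable_Past.
exact: (measurable_near _ _ (measurable_Z j)).
Qed.

(** With a constant [c], a hit at [k] depends only on the first [k] increments of each block, so the
    first hit [D k] is independent of [V k a]. The later near hits are then counted over their
    position [j]. *)
Let pr_fixed_hit c : pr Q (fixed_hit c) * (\sum_(l <= a < A) pr Q (V 0 a)) <=
  \sum_(0 <= j < m.+1) pr Q (G c j).
Proof.
pose D k : set (rseq R) := [set x | Hit c k x /\ forall i, (i < k)%N -> ~ Hit c i x].
have mD k : measurable (D k).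
  apply: measurable_and_set; first exact: measurable_Hit.
  apply: (@measurable_forall _ (rseq R) (fun i => [set x | (i < k)%N -> ~ Hit c i x])) => i.
  by apply: (@measurable_imply _ (rseq R)); apply: measurable_not.
have dD k : determined (fun i => (q <= i < q + k) || (i < k))%N (D k).
  move=> x y xy [Hx nx]; split; first exact: (determined_Hit (leqnn k) xy Hx).
  move=> i ik Hy; apply: (nx i ik); apply: (determined_Hit (ltnW ik) _ Hy) => j jk.
  by apply/esym/xy.
have Ddisj i j x : D i x -> D j x -> i = j.
  by move=> [Hi ni] [Hj nj]; case: (ltngtP i j) => // [/nj|/ni].
have dV k a : determined (fun i => (q + k <= i < q + k + a) || (k <= i < k + a))%N (V k a).
  move=> x y xy [Px Vx]; split.
    by apply: determined_Past Px => i ia; apply: xy; rewrite ia.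
  move: Vx; rewrite /= (@eq_bl _ x y (q + k)); last by move=> i ia; apply: xy; rewrite ia.
  by rewrite (@eq_bl _ x y k)// => i ia; apply: xy; rewrite ia orbT.
pose r := iota 0 (2 * A).+1.
have up : pr Q (fixed_hit c) <= \sum_(k <- r) pr Q (D k).
  apply: pr_union_le => // x [k [kA Hk]].
  have exH : exists k, `[< Hit c k x >] by exists k; apply/asboolP.
  have [k0 /asboolP Hk0 kmin] := ex_minnP exH; exists k0.
    by rewrite mem_iota /= add0n ltnS (leq_trans _ kA)//; apply: kmin; apply/asboolP.
  by split => // i ik Hi; have := kmin i; rewrite asboolT// => /(_ isT); rewrite leqNgt ik.
pose cd j k := (k + l <= j < k + A)%N.
have count j : \sum_(k <- r | cd j k) pr Q (D k `&` V k (j - k)) <= pr Q (G c j).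
  rewrite -big_filter; apply: pr_disjoint_le => //.
  - by move=> k; apply: measurableI.
  - by rewrite filter_uniq// iota_uniq.
  - move=> k x; rewrite mem_filter => /andP[cjk _] [[[Pk Zk] _]].
    have kj : (k <= j)%N by move: cjk; rewrite /cd; lia.
    rewrite /V -addnA subnKC// => -[Pj Vj]; split.
      by apply: Past_cat Pk Pj; rewrite leq_add2l.
    have -> : Z x j + c = (Z x k + c) + (bl x (q + k) (q + j) - bl x k j + 0).
      rewrite /Z (@bl_cat _ _ q (q + k) (q + j)) ?leq_addr ?leq_add2l//.
      by rewrite (@bl_cat _ _ 0 k j)//; ring.
    by apply: le_trans (ler_normD _ _) _; move: Zk Vj => /=; lra.
  - by move=> i j' x _ _ [Di _] [Dj _]; exact: Ddisj Di Dj.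
have low k : k \in r -> pr Q (D k) * (\sum_(l <= a < A) pr Q (V 0 a)) <=
    \sum_(0 <= j < m.+1 | cd j k) pr Q (D k `&` V k (j - k)).
  rewrite mem_iota /= add0n ltnS => kA.
  rewrite [leRHS](eq_bigl (fun j => (k + l <= j) && (j < k + A))%N)//.
  rewrite -[leRHS](@big_nat_widen _ _ _ 0 (k + A) m.+1 (fun j => k + l <= j)%N)/=; last first.
    by rewrite /m; lia.
  rewrite -[leRHS](@big_nat_widenl _ _ _ (k + l) 0 (k + A) xpredT)//=.
  rewrite (addnC _ l) (addnC _ A) [leRHS]big_addn addnK mulr_sumr.
  apply: ler_sum_nat => a /andP[La aA]; rewrite addnK.
  rewrite (pr_indep iidQ (mD k) (measurable_V k a) (@dD k) (@dV k a)) ?pr_V//.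
  by move=> i; move: m_lt_q; rewrite /m; lia.
apply: (@le_trans _ _ (\sum_(0 <= j < m.+1) \sum_(k <- r | cd j k) pr Q (D k `&` V k (j - k))));
  last by apply: ler_sum => j _; exact: count.
under [leRHS]eq_bigr do rewrite big_mkcond/=.
rewrite exchange_big/=.
have H0 : 0 <= \sum_(l <= a < A) pr Q (V 0 a) by rewrite sumr_ge0// => a _; exact: pr_ge0.
apply: le_trans (ler_wpM2r H0 up) _; rewrite mulr_suml.
rewrite big_seq [leRHS]big_seq; apply: ler_sum => k kr.
by apply: le_trans (low k kr) _; rewrite big_mkcond.
Qed.

(** Given the second block, whose displacement [w] satisfies [- 16 s <= w <= 0] on the event of
    [pr_Past_near], the first block must move by [w] up to [2 eta <= 2 s]; hence 18. The product of
    [2 c eta / s] and [1/(8 sqrt(a + 1))] is then bounded with [eta / s >= sqrt l / sqrt(a + 1)]. *)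
Let pr_V_ge (c : R) a : 0 <= c ->
  (forall s w e, 0 < s -> 0 <= e -> `|w| + e <= 18 * s ->
     ((c * e / s)%:E <= normal_prob 0 s [set y : R | (`|y - w| <= e)%R])%E) ->
  (l <= a)%N -> (a <= m)%N -> c / 4 * Num.sqrt l%:R * (a.+1%:R)^-1 <= pr Q (V 0 a).
Proof.
move=> c0 hc la am; have a0 : (0 < a)%N by exact: leq_trans la.
pose s : R := Num.sqrt (a%:R / q%:R).
have sE : s = Num.sqrt a%:R / Num.sqrt q%:R by rewrite /s sqrtrM// sqrtrV.
have s0 : 0 < s by rewrite sqrtr_gt0 divr_gt0// ltr0n.
have es : eta <= s by rewrite sE ler_pM2r ?invr_gt0// ler_sqrt// ler_nat.
pose F : set (rseq R) := Past q (q + a) `&` [set x | - (16 * s) <= bl x q (q + a)].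
have mF : measurable F.
  apply: measurableI; first exact: measurable_Past.
  by apply: (@measurable_le_set _ (rseq R)) => //; exact: measurable_bl.
have step : c * (2 * eta) / s * pr Q F <= pr Q (V 0 a).
  apply: (@pr_splice_ge _ _ _ iidQ (fun i => i < a)%N) => //.
    by rewrite !mulr_ge0// ?invr_ge0 ltW.
  move=> x [Px hx]; set w := bl x q (q + a).
  have aq : (a <= q)%N by move: m_lt_q; lia.
  have w0 : w <= 0.
    by rewrite ltW//; apply: Px; lia.
  have -> : [set y | V 0 a (splice (fun i => i < a)%N (x, y))] = [set y | `|bl y 0 a - w| <= 2 * eta].
    have blq j (y : rseq R) : (q <= j)%N -> bl (splice (fun i => i < a)%N (x, y)) j (q + a) = bl x j (q + a).
      by move=> qj; apply: eq_bl => i ii; rewrite /splice /= ifN//; clear -aq qj ii; lia.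
    have bl0 (y : rseq R) : bl (splice (fun i => i < a)%N (x, y)) 0 a = bl y 0 a.
      by apply: eq_bl => i /andP[_ ii]; rewrite /splice /= ii.
    apply/seteqP; split => y /=; rewrite /V /setI /= !addn0 add0n blq// bl0 addr0 -/w distrC.
      by case.
    move=> h; split => // j /andP[qj ja]; rewrite blq//.
    by apply: Px; rewrite qj.
  rewrite -lee_fin; apply: (@le_trans _ _ (normal_prob 0 s [set y : R | (`|y - w| <= 2 * eta)%R])).
    apply: hc => //; first by rewrite mulr_ge0// ltW.
    by rewrite ler0_norm//; move: hx => /=; rewrite -/w; lra.
  rewrite -prE; last first.
    rewrite (_ : [set y | _] = [set y : rseq R | `|bl y 0 a + (- w)| <= 2 * eta])//.
    by apply: measurable_near; exact: measurable_bl.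
  have mb : measurable [set y : R | `|y - w| <= 2 * eta].
    apply: measurable_le_set => //; apply: measurableT_comp => //.
    exact: measurable_funB.
  by have := gQ.2 0%N a a0 _ mb; rewrite subn0 => ->.
apply: le_trans step; have := pr_Past_near q_gt0 gQ q a; rewrite -/s -/F => near.
have va : 0 < Num.sqrt a.+1%:R :> R by rewrite sqrtr_gt0.
have coef0 : 0 <= c * (2 * eta) / s by rewrite !mulr_ge0// ?invr_ge0 ltW.
apply: le_trans (ler_wpM2l coef0 near).
have ss : s <= Num.sqrt a.+1%:R / Num.sqrt q%:R.
  by rewrite sE ler_pM2r ?invr_gt0// ler_sqrt// ler_nat.
have -> : (a.+1%:R)^-1 = (Num.sqrt a.+1%:R)^-1 * (Num.sqrt a.+1%:R)^-1 :> R.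
  by rewrite -invfM -expr2 sqr_sqrtr.
set v := Num.sqrt a.+1%:R in va ss *.
have -> : c * (2 * eta) / s / (8 * v) = c / 4 * (eta / s) * v^-1.
  by field; rewrite !gt_eqF.
have -> : c / 4 * Num.sqrt l%:R * (v^-1 * v^-1) = c / 4 * (Num.sqrt l%:R * v^-1) * v^-1 by ring.
have vV : 0 <= v^-1 by rewrite invr_ge0 ltW.
apply: ler_wpM2r => //; apply: ler_wpM2l; first by rewrite divr_ge0.
rewrite ler_pdivlMr// -mulrA; apply: ler_wpM2l; first exact: ltW.
rewrite -(ler_pM2l va) mulrA divff ?gt_eqF// mul1r.
exact: ss.
Qed.

Lemma pr_bridge_hit (c lambda K : R) : 0 < c ->
  (forall s w e, 0 < s -> 0 <= e -> `|w| + e <= 18 * s ->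
     ((c * e / s)%:E <= normal_prob 0 s [set y : R | (`|y - w| <= e)%R])%E) ->
  pr Q (bridge_hit lambda K) * (\sum_(l <= a < A) (a.+1%:R)^-1) <= 144 / c.
Proof.
move=> c0 hc.
have A4 : (A <= m)%N by rewrite /m; lia.
set Lam := \sum_(l <= a < A) pr Q (V 0 a).
set H : R := \sum_(l <= a < A) (a.+1%:R)^-1.
have Lam_ge : c / 4 * Num.sqrt l%:R * H <= Lam.
  rewrite mulr_sumr.
  apply: ler_sum_nat => a /andP[la aA]; apply: pr_V_ge => //; first exact: ltW.
  by rewrite (leq_trans (ltnW aA)).
have Lam0 : 0 <= Lam by rewrite sumr_ge0// => a _; exact: pr_ge0.
(* A grid of step [eta] on [[- K, K]]. Replacing [bl x 0 q - lambda] by the grid value below it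
   costs one more [eta], whence the tolerance [2 * eta] in [Hit]. *)
pose ctr (b : nat) : R := - K + b%:R * eta.
pose N := (Num.truncn (2 * K / eta)).+1.
pose B b : set (rseq R) := fixed_hit (ctr b) `&` [set x | `|bl x 0 q + (- (lambda + ctr b))| <= eta].
have mB b : measurable (B b).
  by apply: measurableI => //; apply: measurable_near; exact: measurable_bl.
have mbridge := measurable_bridge_hit lambda K.
have cover : pr Q (bridge_hit lambda K) <= \sum_(b <- iota 0 N) pr Q (B b).
  apply: pr_union_le => // x [[k [kA [Pk Zk]]] xK].
  pose t := (bl x 0 q - lambda + K) / eta.
  have t0 : 0 <= t.
    by apply: divr_ge0; [move: xK; rewrite ler_norml => /andP[]; lra|exact: ltW].
  exists (Num.truncn t).
    rewrite mem_iota /= add0n ltnS; apply: le_truncn.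
    by rewrite ler_pM2r ?invr_gt0//; move: xK; rewrite ler_norml => /andP[]; lra.
  have /andP[t1 t2] := truncn_itv t0.
  have tE : t * eta = bl x 0 q - lambda + K by rewrite divfK// gt_eqF.
  have close : `|bl x 0 q + - (lambda + ctr (Num.truncn t))| <= eta.
    have -> : bl x 0 q + - (lambda + ctr (Num.truncn t)) = (t - (Num.truncn t)%:R) * eta.
      by rewrite mulrBl tE /ctr; ring.
    rewrite normrM (gtr0_norm eta_gt0) ler_piMl ?ltW// ger0_norm ?subr_ge0//.
    by rewrite ltrBlDl natr1.
  split => //; exists k; split => //; split => //.
  have -> : Z x k + ctr (Num.truncn t) =
    (bl x q (q + k) - bl x 0 k + bl x 0 q - lambda) - (bl x 0 q + - (lambda + ctr (Num.truncn t))).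
    by rewrite /Z; ring.
  by apply: le_trans (ler_normB _ _) _; lra.
have mq : (m < q)%N.
  have : (0 < m)%N by rewrite /m muln_gt0.
  by move: m_lt_q; lia.
(* Only the increments in [[m, q[] are resampled, which [fixed_hit] does not see. Their sum must
   fall within [eta] of a given number, and its standard deviation is at least 1/2 because
   [2 * m <= q]. *)
have piece b : pr Q (B b) <= 2 * eta * pr Q (fixed_hit (ctr b)).
  apply: (@pr_splice_le _ _ _ iidQ (fun i => m <= i < q)%N) => //.
  - by rewrite mulr_ge0// ltW.
  - move=> x y [[k [kA Hk]] _]; exists k; split => //.
    apply: (determined_Hit (leqnn k) _ Hk) => i ik; rewrite /splice /= ifN//.
    by move: mq; rewrite /m; lia.
  move=> x _; pose w := lambda + ctr b - bl x 0 m.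
  have mw : measurable [set y : rseq R | `|bl y m q - w| <= eta].
    by apply: measurable_near; exact: measurable_bl.
  apply: (@le_trans _ _ (pr Q [set y : rseq R | `|bl y m q - w| <= eta])).
    apply: le_pr => //; first exact: measurable_section.
    move=> y [_ /=]; rewrite (@bl_cat _ _ 0 m q)//; last exact: ltnW.
    rewrite (@eq_bl _ (splice _ _) x 0); last by move=> i /andP[_ im]; rewrite /splice /= ifN//; lia.
    rewrite (@eq_bl _ (splice _ _) y m); last by move=> i im; rewrite /splice /= im.
    by congr (`|_| <= _); rewrite /w; ring.
  apply: le_trans (pr_bl_ball_le q_gt0 gQ w mq (ltW eta_gt0)) _.
  rewrite mulrC ler_pM2r//.
  have half : 2^-1 <= Num.sqrt ((q - m)%:R / q%:R) :> R.
    rewrite -(@ler_pXn2r _ 2)// ?nnegrE ?invr_ge0 ?sqrtr_ge0// sqr_sqrtr ?divr_ge0//.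
    rewrite ler_pdivlMr// natrB; last exact: ltnW.
    have : (2 * m)%:R <= q%:R :> R by rewrite ler_nat.
    by have := qR_gt0; rewrite natrM; lra.
  by rewrite -[leRHS]invrK lef_pV2 ?posrE ?invr_gt0// (lt_le_trans _ half).
(* At a given [j], the values [ctr b] compatible with [G] differ by at most [8 * eta], so at most 9
   of them occur, and only if [Past q (q + j)] holds. *)
have counting : \sum_(b <- iota 0 N) \sum_(0 <= j < m.+1) pr Q (G (ctr b) j) <=
    9 * (2 * Num.sqrt m.+1%:R).
  rewrite exchange_big /=.
  apply: (@le_trans _ _ (\sum_(0 <= j < m.+1) 9 * stay j)); last first.
    rewrite -mulr_sumr ler_wpM2l//; apply: le_trans (sum_inv_sqrt_le R m.+1).
    by apply: ler_sum => j _; exact: gaussian_stay_upper q_gt0 gQ j.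
  apply: ler_sum => j _.
  have -> : stay j = pr Q (Past q (q + j)).
    by rewrite (pr_Past iidQ nuN noatom) ?leq_addr// addKn.
  have := @pr_sum_le _ _ _ Q _ _ (iota 0 N) [:: tt] (fun b => G (ctr b) j)
    (fun=> Past q (q + j)) 9.
  rewrite big_seq1; apply => //; first by move=> _; exact: measurable_Past.
  move=> x; rewrite big_seq1; apply: sum_indic_close; first by move=> b [].
  move=> b b' [_ Zb] [_ Zb'].
  have : (b%:R - b'%:R) * eta <= 8 * eta.
    have -> : (b%:R - b'%:R) * eta = (Z x j + ctr b) - (Z x j + ctr b') by rewrite /ctr; ring.
    by move: Zb Zb'; rewrite !ler_norml; lra.
  by rewrite ler_pM2r// lerBlDl -natrD ler_nat.
(* [2 eta * 18 sqrt(m + 1) <= 36 eta sqrt q = 36 sqrt l]. The factor [sqrt l] cancels against the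
   one in the lower bound of [Lam], so the estimate is free of [l] and [q]. *)
have total : pr Q (bridge_hit lambda K) * Lam <= 36 * Num.sqrt l%:R.
  apply: (@le_trans _ _ (2 * eta * (9 * (2 * Num.sqrt m.+1%:R)))).
    apply: le_trans (ler_wpM2r Lam0 cover) _.
    apply: le_trans (ler_wpM2l _ counting); last by rewrite mulr_ge0// ltW.
    rewrite mulr_suml mulr_sumr; apply: ler_sum => b _.
    apply: le_trans (ler_wpM2r Lam0 (piece b)) _; rewrite -(mulrA (2 * eta)); apply: ler_wpM2l.
      by rewrite mulr_ge0// ltW.
    exact: pr_fixed_hit.
  have : Num.sqrt m.+1%:R <= Num.sqrt q%:R :> R by rewrite ler_sqrt// ler_nat.
  have : eta * Num.sqrt q%:R = Num.sqrt l%:R by rewrite divfK// gt_eqF.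
  by move=> <-; have := eta_gt0; nra.
rewrite ler_pdivlMr//.
have P0 := pr_ge0 Q (bridge_hit lambda K).
have := ler_wpM2l P0 Lam_ge; move: total.
set p := pr Q _; set u := Num.sqrt l%:R => t1 t2.
have u0 : 0 < u by exact: sl_gt0.
rewrite -(ler_pM2r u0).
have -> : p * H * c * u = 4 * (p * (c / 4 * u * H)) by field.
lra.
Qed.

End bridge_hits.

(** * Grid approximation of paths *)

Section cell_minima_def.
Context (R : realType) (M : nat).

Let cell a i := (a * M <= i <= a.+1 * M)%N.

Definition cell_min (x : nat -> R) a i : Prop :=
  cell a i /\ forall j, cell a j -> bl x 0 i <= bl x 0 j.

(** Cell [a] consists of the grid points of the time interval [[a/N, (a + 1)/N]], cut into [M]
    steps. The event is a near tie between the minimal values over two cells. *)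
Definition cell_tie a b (eta : R) : set (rseq R) := [set x | exists i j,
  cell_min x a i /\ (cell_min x b j /\ `|bl x 0 i - bl x 0 j| <= eta)].

Lemma exists_cell_min (x : nat -> R) a : exists i, cell_min x a i.
Proof.
have [k0 k0M [lt0 ge0]] := first_argmin (fun i => bl x 0 (a * M + i)) M.
exists (a * M + k0)%N; split; first by rewrite /cell mulSn; lia.
move=> j; rewrite /cell mulSn => /andP[j1 j2].
have -> : j = (a * M + (j - a * M))%N by lia.
have [jk|kj] := leqP k0 (j - a * M); first by apply: ge0; lia.
exact/ltW/lt0.
Qed.

End cell_minima_def.

Section cell_minima.
Context (R : realType) (N M : nat) (Q : probability (rseq R) R).
Hypothesis N_gt0 : (0 < N)%N.
Hypothesis M_gt0 : (0 < M)%N.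
Hypothesis gQ : gaussian_walk (N * M) Q.

Let measurable_cell_min a i : measurable [set x : rseq R | cell_min M x a i].
Proof.
apply: (@measurable_conj _ (rseq R)).
apply: (@measurable_forall _ (rseq R) (fun j => [set x | (a * M <= j <= a.+1 * M)%N -> bl x 0 i <= bl x 0 j])) => j.
apply: (@measurable_imply _ (rseq R)).
by apply: (@measurable_le_set _ (rseq R)); exact: measurable_bl.
Qed.

Lemma measurable_cell_tie a b (eta : R) : measurable (cell_tie M a b eta).
Proof.
apply: (@measurable_exists _ (rseq R) (fun i => [set x | exists j,
  cell_min M x a i /\ (cell_min M x b j /\ `|bl x 0 i - bl x 0 j| <= eta)])) => i.
apply: (@measurable_exists _ (rseq R) (fun j => [set x |
  cell_min M x a i /\ (cell_min M x b j /\ `|bl x 0 i - bl x 0 j| <= eta)])) => j.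
apply: (@measurable_and_set _ (rseq R)); first exact: measurable_cell_min.
apply: (@measurable_and_set _ (rseq R)); first exact: measurable_cell_min.
apply: (@measurable_le_set _ (rseq R)) => //; apply: measurableT_comp => //.
by apply: measurable_funB; exact: measurable_bl.
Qed.

(* The increment between the two cells is independent of both of them. *)
Lemma pr_cell_tie a b (eta : R) : (a.+1 < b)%N -> 0 <= eta ->
  pr Q (cell_tie M a b eta) <= eta * Num.sqrt N%:R.
Proof.
move=> ab eta0; pose I i := (a.+1 * M <= i < b * M)%N.
have q0 : (0 < N * M)%N by rewrite muln_gt0 N_gt0.
have abM : (a.+1 * M < b * M)%N by rewrite ltn_pmul2r.
rewrite -[leRHS]mulr1 -[X in _ * X](pr_setT Q).
have N0 : 0 < N%:R :> R by rewrite ltr0n.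
have M0 : 0 < M%:R :> R by rewrite ltr0n.
apply: (@pr_splice_le _ _ _ gQ.1 I) => //; first exact: measurable_cell_tie.
  by rewrite mulr_ge0// sqrtr_ge0.
move=> x _.
have [i0 [ci0 mi0]] := exists_cell_min M x a.
have [j0 [cj0 mj0]] := exists_cell_min M x b.
(* Resampling between the cells does not alter either minimum relative to the end of its cell facing
   the gap. A tie therefore forces the increment across the gap to be within [eta] of [w]. *)
pose w := bl x 0 i0 - bl x 0 (a.+1 * M) - (bl x 0 j0 - bl x 0 (b * M)).
have mw : measurable [set y : rseq R | `|bl y (a.+1 * M) (b * M) - w| <= eta].
  apply: (@measurable_le_set _ (rseq R)) => //; apply: measurableT_comp => //.
  by apply: measurable_funB => //; exact: measurable_bl.
apply: (@le_trans _ _ (pr Q [set y : rseq R | `|bl y (a.+1 * M) (b * M) - w| <= eta])).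
  apply: le_pr => //; first exact: measurable_section (measurable_cell_tie _ _ _).
  move=> y /= [i [j [[ci mi] [[cj mj] hij]]]].
  pose cell c i := (c * M <= i <= c.+1 * M)%N.
  have low k : cell a k -> bl (splice I (x, y)) 0 k = bl x 0 k.
    move=> /andP[_ ck]; apply: eq_bl => l /andP[_ lk].
    by rewrite /splice /= /I ifN//; clear -lk ck; lia.
  have high k : cell b k -> bl (splice I (x, y)) 0 k =
      bl x 0 (a.+1 * M) + bl y (a.+1 * M) (b * M) + (bl x 0 k - bl x 0 (b * M)).
    move=> /andP[bk _].
    rewrite (@bl_cat _ _ 0 (b * M) k)// (@bl_cat _ x 0 (b * M) k)//.
    rewrite (@bl_cat _ _ 0 (a.+1 * M) (b * M))//; last exact: ltnW.
    rewrite (@eq_bl _ (splice I (x, y)) x 0); last first.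
      by move=> l /andP[_ lk]; rewrite /splice /= /I ifN//; clear -lk; lia.
    rewrite (@eq_bl _ (splice I (x, y)) y (a.+1 * M)); last first.
      by move=> l lk; rewrite /splice /= /I lk.
    rewrite (@eq_bl _ (splice I (x, y)) x (b * M)); last first.
      by move=> l /andP[lk _]; rewrite /splice /= /I ifN//; clear -lk; lia.
    ring.
  have Ei : bl x 0 i = bl x 0 i0.
    by apply/eqP; rewrite eq_le mi0// -(low _ ci) -(low _ ci0) mi.
  have Ej : bl x 0 j = bl x 0 j0.
    by apply/eqP; rewrite eq_le mj0// andbT; have := mj _ cj0; rewrite !high//; lra.
  move: hij; rewrite low// high// Ei Ej distrC; congr (`|_| <= _).
  by rewrite /w; ring.
apply: le_trans (pr_bl_ball_le q0 gQ w abM eta0) _.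
rewrite ler_wpM2l// -[leRHS]invrK.
have sN : 0 < Num.sqrt N%:R :> R by rewrite sqrtr_gt0.
have key : (Num.sqrt N%:R)^-1 <= Num.sqrt ((b * M - a.+1 * M)%:R / (N * M)%:R) :> R.
  rewrite -sqrtrV// ler_sqrt; last by rewrite divr_ge0.
  rewrite natrM -mulnBl natrM invfM mulrACA divff ?gt_eqF// mulr1.
  by rewrite ler_peMl ?invr_ge0// ler1n subn_gt0.
have sN' : 0 < (Num.sqrt N%:R)^-1 :> R by rewrite invr_gt0.
have sp := lt_le_trans sN' key.
by rewrite lef_pV2 ?posrE.
Qed.

End cell_minima.

(** * Minimisers of continuous paths near a strict minimum *)

Section path_analysis.
Context (R : realType) (f : R -> R).
Hypothesis cf : {within `[0, +oo[, continuous f}.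

Lemma path_continuity s e : 0 <= s -> 0 < e -> exists2 g : R, 0 < g &
  forall u, 0 <= u -> `|u - s| < g -> `|f u - f s| < e.
Proof.
move=> s0 e0.
have sA : [set` `[0, +oo[] s by rewrite /= in_itv/= s0.
have /subspace_continuousP/(_ s sA)/cvgrPdist_lt/(_ e e0) := cf.
rewrite near_withinE => /nbhs_ballP[g /= g0 hg]; exists g => // u u0 us.
rewrite distrC; apply: hg; last by rewrite /= in_itv/= u0.
by rewrite /ball /= distrC.
Qed.

Lemma path_min a b : 0 <= a -> a <= b ->
  exists2 c, a <= c <= b & forall u, a <= u <= b -> f c <= f u.
Proof.
move=> a0 ab; have cab : {within `[a, b], continuous f}.
  apply: continuous_subspaceW cf => u /=; rewrite !in_itv/= andbT => /andP[au _].
  exact: le_trans au.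
have [c + fc] := EVT_min ab cab; rewrite in_itv/= => ac.
by exists c => // u au; apply: fc; rewrite in_itv.
Qed.

(** By compactness the minimum [f c] over [[a, s - e]] exceeds [f s], and by continuity [f u < f c]
    for [u] close to [s]; a point [v] with [f v <= f u] cannot lie in [[a, s - e]]. *)
Lemma strict_min_left_close a s e : 0 <= a -> a <= s ->
  (forall u, a <= u < s -> f s < f u) -> 0 < e -> exists2 g : R, 0 < g &
  forall u v, a <= u <= s -> a <= v <= s -> s - u < g -> f v <= f u -> s - v < e.
Proof.
move=> a0 as_ strict e0; have [sea|aes] := ltP (s - e) a.
  by exists 1 => // u v _ /andP[av _] _ _; lra.
have [c /andP[ac ce] fc] := path_min a0 aes.
have fsc : f s < f c by apply: strict; lra.
have s0 : 0 <= s by lra.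
have e'0 : 0 < f c - f s by rewrite subr_gt0.
have [g g0 hg] := path_continuity s0 e'0.
exists g => // u v /andP[au us] /andP[av vs] sug fvu.
have : `|f u - f s| < f c - f s by apply: hg; [lra|rewrite ler0_norm; lra].
rewrite ltr_norml => /andP[_ fu].
rewrite ltNge; apply/negP => sve.
have : f c <= f v by apply: fc; lra.
lra.
Qed.

Lemma strict_min_right_close s b e : 0 <= s -> s <= b ->
  (forall u, s < u <= b -> f s < f u) -> 0 < e -> exists2 g : R, 0 < g &
  forall u v, s <= u <= b -> s <= v <= b -> u - s < g -> f v <= f u -> v - s < e.
Proof.
move=> s0 sb strict e0; have [sea|aes] := ltP b (s + e).
  by exists 1 => // u v _ /andP[_ vb] _ _; lra.
have [c /andP[ac ce] fc] := path_min (addr_ge0 s0 (ltW e0)) aes.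
have fsc : f s < f c by apply: strict; lra.
have e'0 : 0 < f c - f s by rewrite subr_gt0.
have [g g0 hg] := path_continuity s0 e'0.
exists g => // u v /andP[su ub] /andP[sv vb] sug fvu.
have : `|f u - f s| < f c - f s by apply: hg; [lra|rewrite ger0_norm; lra].
rewrite ltr_norml => /andP[_ fu].
rewrite ltNge; apply/negP => sve.
have : f c <= f v by apply: fc; lra.
lra.
Qed.

End path_analysis.

(** * From minima of a path to minima on its grids *)

Section grid_hits.
Context (R : realType) (f : R -> R).
Hypothesis cf : {within `[0, +oo[, continuous f}.

Definition grid_increments (f : R -> R) (tau : R) (q : nat) : nat -> R :=
  fun i => f (tau + i.+1%:R / q%:R) - f (tau + i%:R / q%:R).

Lemma bl_grid tau q a b : (a <= b)%N ->
  bl (grid_increments f tau q) a b = f (tau + b%:R / q%:R) - f (tau + a%:R / q%:R).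
Proof. by move=> ab; rewrite /bl /grid_increments telescope_sumr. Qed.

(** Take the first minimiser over the grid points up to [s]. Its value is at most that at the last
    such point, less than [1/q] away from [s], so it is close to [s]. *)
Lemma grid_Past tau s e : 0 <= tau -> tau <= s ->
  (forall u, tau <= u < s -> f s < f u) -> 0 < e -> exists q1 : nat,
  forall q, (q1 <= q)%N -> (0 < q)%N -> exists k, [/\
    tau + k%:R / q%:R <= s, s - e < tau + k%:R / q%:R &
    forall i, (i < k)%N -> f (tau + k%:R / q%:R) < f (tau + i%:R / q%:R)].
Proof.
move=> t0 ts strict e0.
have [g g0 hg] := strict_min_left_close cf t0 ts strict e0.
exists (Num.truncn g^-1).+1 => q gq q_gt0.
have q0' : 0 < q%:R :> R by rewrite ltr0n.
have gq1 : q%:R^-1 < g.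
  rewrite -[ltRHS]invrK ltf_pV2 ?posrE ?invr_gt0//.
  apply: lt_le_trans (truncnS_gt _) _; by rewrite ler_nat.
have x0 : 0 <= (s - tau) * q%:R by rewrite mulr_ge0 ?subr_ge0.
have /andP[n1 n2] := truncn_itv x0; set n := Num.truncn _ in n1 n2.
have [k kn [lt_k ge_k]] := first_argmin (fun i => f (tau + i%:R / q%:R)) n.
have le_s i : (i <= n)%N -> tau + i%:R / q%:R <= s.
  move=> ni; rewrite -lerBrDl ler_pdivrMr//; apply: le_trans n1.
  by rewrite ler_nat.
have ge_tau i : tau <= tau + i%:R / q%:R by rewrite lerDl divr_ge0.
exists k; split => //; first exact: le_s.
suff : s - (tau + k%:R / q%:R) < e by lra.
apply: (hg (tau + n%:R / q%:R)); rewrite ?ge_tau ?le_s//; last by apply: ge_k; rewrite kn leqnn.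
apply: le_lt_trans gq1; rewrite -[leRHS]div1r ler_pdivlMr// mulrBl mulrDl divfK ?gt_eqF//.
move: n2; rewrite -natr1; lra.
Qed.

(** The minimiser is sought from the first grid point strictly after [s]. Together with [grid_Past],
    which stays on the left, this orders the two indices of a pair hit. *)
Lemma grid_Fut tau b s e : 0 <= tau -> tau <= s -> s < b ->
  (forall u, s < u <= b -> f s < f u) -> 0 < e -> exists q1 : nat,
  forall q m, (q1 <= q)%N -> (0 < q)%N -> tau + m%:R / q%:R = b -> exists k, [/\ (k <= m)%N,
    s < tau + k%:R / q%:R, tau + k%:R / q%:R < s + e &
    forall i, (k <= i <= m)%N -> f (tau + k%:R / q%:R) <= f (tau + i%:R / q%:R)].
Proof.
move=> t0 ts sb strict e0; have s0 : 0 <= s by lra.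
have [g g0 hg] := strict_min_right_close cf s0 (ltW sb) strict e0.
exists (Num.truncn g^-1).+1 => q m gq q_gt0 mb.
have q0' : 0 < q%:R :> R by rewrite ltr0n.
have gq1 : q%:R^-1 < g.
  rewrite -[ltRHS]invrK ltf_pV2 ?posrE ?invr_gt0//.
  apply: lt_le_trans (truncnS_gt _) _; by rewrite ler_nat.
have x0 : 0 <= (s - tau) * q%:R by rewrite mulr_ge0 ?subr_ge0.
have /andP[n1 n2] := truncn_itv x0; set n := Num.truncn _ in n1 n2.
have nm : (n < m)%N.
  rewrite -(ltr_nat R); apply: le_lt_trans n1 _.
  by rewrite -(ltr_pM2r (x := q%:R^-1)) ?invr_gt0// mulfK ?gt_eqF//; lra.
have [k kn [lt_k ge_k]] := first_argmin (fun i => f (tau + (n.+1 + i)%:R / q%:R)) (m - n.+1).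
have gt_s i : s < tau + (n.+1 + i)%:R / q%:R.
  rewrite -ltrBlDl ltr_pdivlMr//; apply: lt_le_trans n2 _.
  by rewrite ler_nat leq_addr.
have le_b i : (i <= m)%N -> tau + i%:R / q%:R <= b.
  by move=> im; rewrite -mb lerD2l ler_pM2r ?invr_gt0// ler_nat.
have fk0 : f (tau + (n.+1 + k)%:R / q%:R) <= f (tau + (n.+1 + 0)%:R / q%:R).
  by case: (posnP k) => [->//|k0]; apply/ltW/lt_k.
have km : (n.+1 + k <= m)%N by clear -kn nm; lia.
have n1m : (n.+1 + 0 <= m)%N by rewrite addn0.
exists (n.+1 + k)%N; split => //.
  suff : tau + (n.+1 + k)%:R / q%:R - s < e by lra.
  apply: (hg (tau + (n.+1 + 0)%:R / q%:R)) => //.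
  - by rewrite (ltW (gt_s _)) le_b.
  - by rewrite (ltW (gt_s _)) le_b.
  apply: le_lt_trans gq1; rewrite addn0 -[leRHS]div1r ler_pdivlMr// mulrBl mulrDl divfK ?gt_eqF//.
  by move: n1; rewrite -natr1; lra.
move=> i /andP[ki im]; have n1i : (n.+1 <= i)%N by exact: leq_trans (leq_addr _ _) ki.
by have := ge_k (i - n.+1)%N; rewrite subnKC// leq_sub2r// leq_subRL// ki; apply.
Qed.

(** Around two interior minimisers there are separated cells inside [[al, be]], both with minimum
    [c] for the path. By continuity both grid minima lie in [[c, c + eta[] on fine grids, which is a
    near tie. *)
Lemma no_two_minima (al be u1 u2 c : R) :
  (forall N a b, (0 < N)%N -> (a.+1 < b)%N -> exists2 eta : R, 0 < eta &
    forall M1, exists M, [/\ (M1 <= M)%N, (0 < M)%N &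
    ~ cell_tie M a b eta (grid_increments f 0 (N * M))]) ->
  0 <= al -> al < u1 -> u1 < u2 -> u2 < be ->
  (forall u, al <= u <= be -> c <= f u) -> f u1 = c -> f u2 = c -> False.
Proof.
move=> notie al0 alu1 u12 u2be minc f1 f2.
(* With [1/N < gap], both cells fit into [[al, be]] and at least one full cell separates them. *)
pose gap := Num.min (u1 - al) (Num.min ((u2 - u1) / 2) (be - u2)).
have gap0 : 0 < gap by rewrite !lt_min !subr_gt0 alu1 u2be divr_gt0// subr_gt0.
have [gap1 gap2 gap3] : [/\ gap <= u1 - al, gap <= (u2 - u1) / 2 & gap <= be - u2].
  by rewrite /gap !ge_min !lexx !orbT.
pose N := (Num.truncn gap^-1).+1.
have N0 : 0 < N%:R :> R by rewrite ltr0n.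
have Ngap : N%:R^-1 < gap.
  by rewrite -[ltRHS]invrK ltf_pV2 ?posrE ?invr_gt0// truncnS_gt.
have cellP (u : R) : 0 <= u -> exists a : nat, a%:R / N%:R <= u < a.+1%:R / N%:R.
  move=> u0; have x0 : 0 <= u * N%:R by rewrite mulr_ge0.
  have /andP[n1 n2] := truncn_itv x0; exists (Num.truncn (u * N%:R)).
  by rewrite ler_pdivrMr// ltr_pdivlMr// n1 n2.
have [a /andP[a1 a2]] := cellP u1 ltac:(lra).
have [b /andP[b1 b2]] := cellP u2 ltac:(lra).
have succ k : k.+1%:R / N%:R = k%:R / N%:R + N%:R^-1 :> R by rewrite -natr1 mulrDl div1r.
have ab : (a.+1 < b)%N.
  rewrite -(ltr_nat R) -(ltr_pM2r (x := N%:R^-1)) ?invr_gt0// succ.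
  by move: b2; rewrite succ; lra.
have [eta eta0 /= notieM] := notie N a b isT ab.
have u10 : 0 <= u1 by lra.
have u20 : 0 <= u2 by lra.
have [g1 g10 hg1] := path_continuity cf u10 eta0.
have [g2 g20 hg2] := path_continuity cf u20 eta0.
pose g := Num.min g1 g2.
have g0 : 0 < g by rewrite lt_min g10.
have [M [M1 M0 tieM]] := notieM (Num.truncn g^-1).+1.
have MR0 : 0 < M%:R :> R by rewrite ltr0n.
pose q := (N * M)%N.
have q0 : 0 < q%:R :> R by rewrite ltr0n muln_gt0.
have qg : q%:R^-1 < g.
  rewrite -[ltRHS]invrK ltf_pV2 ?posrE ?invr_gt0//.
  apply: lt_le_trans (truncnS_gt _) _; rewrite ler_nat.
  by apply: leq_trans M1 _; rewrite /q leq_pmull.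
have cellE k i : (k * M <= i <= k.+1 * M)%N -> (k%:R / N%:R : R) <= (i%:R / q%:R : R) <= (k.+1%:R / N%:R : R).
  have E (l : nat) : l%:R / N%:R = (l * M)%:R / q%:R :> R.
    by rewrite /q !natrM invfM mulrACA divff ?mulr1// gt_eqF.
  move=> /andP[h1 h2]; have := E k.+1; have := E k => -> ->.
  by rewrite !ler_pM2r ?invr_gt0// !ler_nat h1.
have blE i : bl (grid_increments f 0 q) 0 i = f (i%:R / q%:R) - f 0.
  by rewrite bl_grid// mul0r !add0r.
have attain k (u : R) i : k%:R / N%:R <= u < k.+1%:R / N%:R -> (al <= k%:R / N%:R) ->
    k.+1%:R / N%:R <= be -> f u = c -> (forall w, 0 <= w -> `|w - u| < g -> `|f w - f u| < eta) ->
    cell_min M (grid_increments f 0 q) k i -> c <= f (i%:R / q%:R) < c + eta.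
  move=> /andP[ku uk] alk kbe fu hu [ci mi].
  have /andP[i1 i2] := cellE k i ci.
  rewrite minc /=; last by rewrite (le_trans alk)// (le_trans i2).
  have x0 : 0 <= u * q%:R by rewrite mulr_ge0//; apply: le_trans ku; rewrite divr_ge0.
  have /andP[n1 n2] := truncn_itv x0; set n := Num.truncn _ in n1 n2.
  have cn : (k * M <= n <= k.+1 * M)%N.
    move: ku uk; rewrite ler_pdivrMr// ltr_pdivlMr// => ku uk.
    apply/andP; split.
      rewrite -ltnS -(ltr_nat R) natrM; apply: le_lt_trans n2.
      by rewrite /q natrM mulrA ler_pM2r.
    rewrite -(ler_nat R) natrM; apply: le_trans n1 _; rewrite /q natrM mulrA ler_pM2r//.
    exact: ltW.
  have nu : `|n%:R / q%:R - u| < g.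
    rewrite ler0_norm; last by rewrite subr_le0 ler_pdivrMr.
    apply: lt_trans qg; rewrite opprB -[ltRHS]div1r ltr_pdivlMr// mulrBl divfK ?gt_eqF//.
    by move: n2; rewrite -natr1; lra.
  have := hu _ _ nu; rewrite divr_ge0// => /(_ isT); rewrite ltr_norml fu => /andP[_ fn].
  by have := mi n cn; rewrite !blE; lra.
apply: tieM.
have [i mi] := exists_cell_min M (grid_increments f 0 q) a.
have [j mj] := exists_cell_min M (grid_increments f 0 q) b.
exists i, j; split => //; split => //.
have hi : c <= f (i%:R / q%:R) < c + eta.
  apply: (attain a u1) => //; rewrite ?a1 ?a2//.
  - by move: a2; rewrite succ; lra.
  - by rewrite succ; lra.
  - by move=> w w0 wu; apply: hg1 => //; rewrite (lt_le_trans wu)// ge_min lexx.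
have hj : c <= f (j%:R / q%:R) < c + eta.
  apply: (attain b u2) => //; rewrite ?b1 ?b2//.
  - by move: b2; rewrite succ; lra.
  - by rewrite succ; lra.
  - by move=> w w0 wu; apply: hg2 => //; rewrite (lt_le_trans wu)// ge_min lexx orbT.
move: hi hj => /andP[hi1 hi2] /andP[hj1 hj2].
by rewrite !blE ler_norml; apply/andP; split; lra.
Qed.

End grid_hits.

(** Asking for arbitrarily large [M] only, the negation reads: for some pair of cells and every
    [eta], ties occur on all sufficiently fine grids. This is the form of event that
    [negligible_eventually] handles. *)
Definition tie_free (R : realType) (f : R -> R) := forall N a b, (0 < N)%N -> (a.+1 < b)%N ->
  exists2 eta : R, 0 < eta & forall M1, exists M, [/\ (M1 <= M)%N, (0 < M)%N &
    ~ cell_tie M a b eta (grid_increments f 0 (N * M))].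

Section hits_of_paths.
Context (R : realType) (f : R -> R).
Hypothesis cf : {within `[0, +oo[, continuous f}.

(** [no_two_minima] concerns interior points, whereas [t] is an end point. So at most one more
    minimiser [u] lies inside the interval, and stopping halfway to [u] removes it. *)
Lemma tie_free_strict_right t de : tie_free f -> 0 <= t -> 0 < de ->
  (forall u, t <= u <= t + de -> f t <= f u) ->
  exists2 d1, 0 < d1 <= de & forall u, t < u <= t + d1 -> f t < f u.
Proof.
move=> tf t0 de0 minf.
have [[u [tu ud fu]]|nu] := pselect (exists u, [/\ t < u, u < t + de & f u = f t]).
  exists ((u - t) / 2); first by apply/andP; split; lra.
  move=> v /andP[tv vu]; rewrite lt_neqAle minf ?andbT; last by apply/andP; split; lra.
  apply/eqP => fv; apply: (no_two_minima cf tf t0 tv _ ud minf (esym fv) fu); lra.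
exists (de / 2); first by apply/andP; split; lra.
move=> v /andP[tv vd]; rewrite lt_neqAle minf ?andbT; last by apply/andP; split; lra.
by apply/eqP => fv; apply: nu; exists v; split => //; lra.
Qed.

Lemma tie_free_strict_left s de : tie_free f -> 0 < de -> de <= s ->
  (forall u, s - de <= u <= s -> f s <= f u) ->
  exists2 d1, 0 < d1 <= de & forall u, s - d1 <= u < s -> f s < f u.
Proof.
move=> tf de0 ds minf; have sd0 : 0 <= s - de by lra.
have [[u [tu ud fu]]|nu] := pselect (exists u, [/\ s - de < u, u < s & f u = f s]).
  exists ((s - u) / 2); first by apply/andP; split; lra.
  move=> v /andP[tv vu]; rewrite lt_neqAle minf ?andbT; last by apply/andP; split; lra.
  apply/eqP => fv; apply: (no_two_minima cf tf sd0 tu _ vu minf fu (esym fv)); lra.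
exists (de / 2); first by apply/andP; split; lra.
move=> v /andP[tv vd]; rewrite lt_neqAle minf ?andbT; last by apply/andP; split; lra.
by apply/eqP => fv; apply: nu; exists v; split => //; lra.
Qed.

Section at_a_time.
Variables (t tau : R) (N J : nat).
Hypothesis N_gt0 : (0 < N)%N.
Hypothesis tau_ge0 : 0 <= tau.
Hypothesis tau_le : tau <= t.
Hypothesis lt_tau : t < tau + (2 * N%:R)^-1.
Hypothesis strict_left : forall u, tau + 1 <= u < t + 1 -> f (t + 1) < f u.

Let N0 : 0 < N%:R :> R. Proof. by rewrite ltr0n. Qed.
Let J0 : 0 < (2 ^ J)%:R :> R. Proof. by rewrite ltr0n expn_gt0. Qed.

Let gridS q k : (0 < q)%N -> tau + (q + k)%:R / q%:R = tau + 1 + k%:R / q%:R.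
Proof. by move=> q0; rewrite natrD mulrDl divff ?addrA// pnatr_eq0 -lt0n. Qed.

Lemma eventually_pair_hit :
  (forall u, t < u <= tau + N%:R^-1 -> f t < f u) ->
  exists L0, forall L, (L0 <= L)%N -> (0 < L)%N ->
    let A := (2 ^ J * L)%N in let q := (N * (4 * A))%N in
    pair_hit L A q (grid_increments f tau q).
Proof.
have tau0 := tau_ge0; have tau1 := tau_le; have tau2 := lt_tau.
move=> strict_right.
(* The first bound gives [2 * e * q <= L], so that two grid minimisers within [e] of their limits
   are less than [L] steps apart. The second keeps [k] below [2 * A], the end of the window. *)
pose e := Num.min (8 * N%:R * (2 ^ J)%:R)^-1 (tau + (2 * N%:R)^-1 - t).
have e0 : 0 < e by rewrite lt_min invr_gt0 !mulr_gt0// subr_gt0.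
have [e1 e2] : e <= (8 * N%:R * (2 ^ J)%:R)^-1 /\ e <= tau + (2 * N%:R)^-1 - t.
  by rewrite /e !ge_min !lexx orbT.
have NV : (2 * N%:R)^-1 < N%:R^-1 :> R.
  by rewrite ltf_pV2 ?posrE ?mulr_gt0// ltr_pMl// ltr1n.
have tb : t < tau + N%:R^-1 by lra.
have [qP hP] := grid_Past cf (addr_ge0 tau_ge0 ler01) (lerD tau_le (lexx 1)) strict_left e0.
have [qF hF] := grid_Fut cf tau_ge0 tau_le tb strict_right e0.
exists (qP + qF)%N => L LL L_gt0 A q.
have L0 : 0 < L%:R :> R by rewrite ltr0n.
have A_gt0 : (0 < A)%N by rewrite /A muln_gt0 expn_gt0.
have q_gt0 : (0 < q)%N by rewrite /q muln_gt0 N_gt0 muln_gt0 A_gt0.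
have q0 : 0 < q%:R :> R by rewrite ltr0n.
have Lq : (L <= q)%N.
  rewrite /q /A mulnA mulnA -[leqLHS]mul1n leq_mul2r; apply/orP; right.
  by rewrite !muln_gt0 N_gt0 expn_gt0.
have qE : q%:R = N%:R * 4 * (2 ^ J)%:R * L%:R :> R by rewrite /q /A !natrM !mulrA.
have [k' [k's sk' hk']] := hP q (leq_trans (leq_trans (leq_addr _ _) LL) Lq) q_gt0.
have mq : tau + (4 * A)%:R / q%:R = tau + N%:R^-1.
  rewrite /q (natrM _ N) invfM mulrCA divff ?mulr1// pnatr_eq0 -lt0n.
  by rewrite muln_gt0.
have [k [km tk kt hk]] := hF q _ (leq_trans (leq_trans (leq_addl _ _) LL) Lq) q_gt0 mq.
have k'q : k'%:R <= (t - tau) * q%:R by rewrite -ler_pdivrMr//; lra.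
have qk' : (t - tau - e) * q%:R < k'%:R by rewrite -ltr_pdivlMr//; lra.
have qk : (t - tau) * q%:R < k%:R by rewrite -ltr_pdivlMr//; lra.
have kq : k%:R < (t - tau + e) * q%:R by rewrite -ltr_pdivrMr//; lra.
have eqL : 2 * (e * q%:R) <= L%:R.
  have : e * q%:R <= (8 * N%:R * (2 ^ J)%:R)^-1 * q%:R by rewrite ler_pM2r.
  have -> : (8 * N%:R * (2 ^ J)%:R)^-1 * q%:R = L%:R / 2 :> R.
    by rewrite qE; field; rewrite !gt_eqF.
  lra.
have halfq : (2 * N%:R)^-1 * q%:R = (2 * A)%:R :> R.
  rewrite qE /A !natrM; field; by rewrite gt_eqF.
exists k', k; split; [split|split].
- apply/andP; split.
    by rewrite -(ler_nat R); lra.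
  by rewrite -(ler_nat R) natrD; lra.
- rewrite -(ler_nat R) -halfq; apply/ltW; apply: lt_le_trans kq _.
  by rewrite ler_pM2r//; lra.
- move=> j /andP[qj jk]; rewrite bl_grid; last exact: ltnW.
  rewrite subr_lt0 -(subnKC qj) !gridS//; apply: hk'.
  by rewrite ltn_subLR.
move=> j jk; rewrite bl_grid; last by have /andP[] := jk.
by rewrite subr_ge0; exact: hk.
Qed.

Lemma eventually_bridge_hit lambda K : f (t + 1) = f t + lambda ->
  `|f (tau + 1) - f tau - lambda| <= K ->
  exists l0, forall l, (l0 <= l)%N -> (0 < l)%N ->
    let A := (2 ^ J * l)%N in let q := (N * (4 * A))%N in
    bridge_hit q l A lambda K (grid_increments f tau q).
Proof.
have tau0 := tau_ge0; have tau1 := tau_le; have tau2 := lt_tau.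
move=> ft fK.
(* This equals [sqrt l / sqrt q] for every [l], because [q] is proportional to [l]: the spatial
   tolerance stays fixed as the mesh is refined, and each end of the unit interval may use half of
   it. *)
pose eta := (Num.sqrt (N%:R * 4 * (2 ^ J)%:R))^-1 : R.
have eta0 : 0 < eta by rewrite invr_gt0 sqrtr_gt0 !mulr_gt0.
have eta20 : 0 < eta / 2 by rewrite divr_gt0.
have t_ge0 : 0 <= t by exact: le_trans tau_ge0 tau_le.
have t1_ge0 : 0 <= t + 1 by rewrite addr_ge0.
have [g1 g10 hg1] := path_continuity cf t_ge0 eta20.
have [g2 g20 hg2] := path_continuity cf t1_ge0 eta20.
pose e := Num.min g1 g2.
have e0 : 0 < e by rewrite lt_min g10.
have [qP hP] := grid_Past cf (addr_ge0 tau_ge0 ler01) (lerD tau_le (lexx 1)) strict_left e0.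
exists qP => l ll l_gt0 A q.
have l0 : 0 < l%:R :> R by rewrite ltr0n.
have A_gt0 : (0 < A)%N by rewrite /A muln_gt0 expn_gt0.
have q_gt0 : (0 < q)%N by rewrite /q muln_gt0 N_gt0 muln_gt0 A_gt0.
have q0 : 0 < q%:R :> R by rewrite ltr0n.
have lq : (l <= q)%N.
  rewrite /q /A mulnA mulnA -[leqLHS]mul1n leq_mul2r; apply/orP; right.
  by rewrite !muln_gt0 N_gt0 expn_gt0.
have qE : q%:R = N%:R * 4 * (2 ^ J)%:R * l%:R :> R by rewrite /q /A !natrM !mulrA.
have etaE : Num.sqrt l%:R / Num.sqrt q%:R = eta.
  rewrite qE sqrtrM ?mulr_ge0// invfM mulrCA divff ?mulr1// gt_eqF//.
  by rewrite sqrtr_gt0.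
have [k [ks sk hk]] := hP q (leq_trans ll lq) q_gt0.
have kq : k%:R <= (t - tau) * q%:R by rewrite -ler_pdivrMr//; lra.
have halfq : (2 * N%:R)^-1 * q%:R = (2 * A)%:R :> R.
  rewrite qE /A !natrM; field; by rewrite gt_eqF.
have kn0 : 0 <= k%:R / q%:R :> R by rewrite divr_ge0.
split.
  exists k; split.
    rewrite -(ler_nat R) -halfq; apply: le_trans kq _.
    by rewrite ler_pM2r//; lra.
  split.
    move=> j /andP[qj jk]; rewrite bl_grid; last exact: ltnW.
    rewrite subr_lt0 -(subnKC qj) !gridS//; apply: hk.
    by rewrite ltn_subLR.
  rewrite etaE !bl_grid ?leq_addr// gridS//.
  have -> : q%:R / q%:R = 1 :> R by rewrite divff// gt_eqF.
  rewrite mul0r addr0.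
  have E1 : `|f (tau + 1 + k%:R / q%:R) - f (t + 1)| < eta / 2.
    apply: hg2; first lra.
    rewrite ler0_norm; last by lra.
    by have : e <= g2; [rewrite ge_min lexx orbT|lra].
  have E2 : `|f (tau + k%:R / q%:R) - f t| < eta / 2.
    apply: hg1; first lra.
    rewrite ler0_norm; last by lra.
    by have : e <= g1; [rewrite ge_min lexx|lra].
  have -> : f (tau + 1 + k%:R / q%:R) - f (tau + 1) - (f (tau + k%:R / q%:R) - f tau) +
      (f (tau + 1) - f tau) - lambda =
    (f (tau + 1 + k%:R / q%:R) - f (t + 1)) - (f (tau + k%:R / q%:R) - f t).
    by rewrite ft; ring.
  by apply: le_trans (ler_normB _ _) _; lra.
rewrite bl_grid//.
have -> : q%:R / q%:R = 1 :> R by rewrite divff// gt_eqF.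
by rewrite mul0r addr0.
Qed.

End at_a_time.

End hits_of_paths.

(** * Brownian motion *)

Section negligible_events.
Context d (T : measurableType d) (R : realType) (P : probability T R).

(** [S] is contained in the lower limit of the [E n], an increasing union of sets [F n] of
    probability at most [e]. Since [S] need not be measurable, it is covered for each
    [e = 1/(n + 1)] and the covers are intersected. *)
Lemma negligible_eventually (S : set T) :
  (forall e : R, 0 < e -> exists E : nat -> set T, [/\ (forall n, measurable (E n)),
     (forall n, pr P (E n) <= e) &
     forall w, S w -> exists n0, forall n, (n0 <= n)%N -> E n w]) ->
  P.-negligible S.
Proof.
move=> hS.
have cover e : 0 < e -> exists L : set T, [/\ measurable L, (P L <= e%:E)%E & S `<=` L].
  move=> /hS[E [mE PE SE]].
  pose F n := \bigcap_(k in [set k | (n <= k)%N]) E k.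
  have mF n : measurable (F n) by apply: bigcap_measurableType => k _.
  exists (\bigcup_n F n); split.
  - exact: bigcupT_measurable.
  - have cvgF : P (F n) @[n --> \oo] --> P (\bigcup_n F n).
      apply: nondecreasing_cvg_mu => //; first exact: bigcupT_measurable.
      move=> n m nm; apply/subsetPset => w Fw k /= mk.
      by apply: Fw => /=; exact: leq_trans mk.
    apply: (cvge_le _ cvgF); apply: nearW => n.
    apply: (@le_trans _ _ (P (E n))).
      by apply: le_measure; rewrite ?inE// => w; apply; exact: leqnn.
    by rewrite prE// lee_fin.
  - by move=> w /SE[n0 hn0]; exists n0.
have inv0 n : 0 < n.+1%:R^-1 :> R by rewrite invr_gt0.
pose L n := sval (cid (cover _ (inv0 n))).
have LP n : [/\ measurable (L n), (P (L n) <= (n.+1%:R^-1)%:E)%E & S `<=` L n] :=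
  svalP (cid (cover _ (inv0 n))).
have mL n : measurable (L n) by have [] := LP n.
exists (\bigcap_n L n); split.
- exact: bigcapT_measurable.
- apply/eqP; rewrite eq_le measure_ge0 andbT.
  apply/lee_addgt0Pr => e e0; rewrite add0e.
  pose n := Num.truncn e^-1.
  apply: (@le_trans _ _ (P (L n))).
    apply: le_measure; rewrite ?inE//; first exact: bigcapT_measurable.
    by move=> w; apply.
  apply: (@le_trans _ _ (n.+1%:R^-1)%:E); first by have [] := LP n.
  rewrite lee_fin -[leRHS]invrK lef_pV2 ?posrE ?invr_gt0//.
  by apply/ltW; exact: truncnS_gt.
- by move=> w Sw n _; have [_ _] := LP n; exact.
Qed.

End negligible_events.

Section brownian_grid.
Context d (T : measurableType d) (R : realType) (P : probability T R) (B : R -> T -> R).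
Hypothesis hB : brownian_motion P B.

(** [Q] is the law of the grid increments; block sums telescope to Brownian increments. Every
    estimate on walks reaches [B] through this transfer. *)
Lemma brownian_grid_walk (tau : R) (q : nat) : 0 <= tau -> (0 < q)%N ->
  exists2 Q : probability (rseq R) R, gaussian_walk q Q &
  forall E : set (rseq R), measurable E ->
    let F := [set w | E (grid_increments (B ^~ w) tau q)] in
    measurable F /\ pr P F = pr Q E.
Proof.
move=> tau0 q0; have qR0 : 0 < q%:R :> R by rewrite ltr0n.
pose phi w : rseq R := grid_increments (B ^~ w) tau q.
pose t (i : nat) := tau + i%:R / q%:R.
have t0 i : 0 <= t i by rewrite addr_ge0// divr_ge0.
have mB s t' : 0 <= s -> 0 <= t' -> measurable_fun setT (fun w => B s w - B t' w).
  by move=> s0 t'0; apply: measurable_funB; exact: (bm_measurable hB).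
have mphi : measurable_fun setT phi.
  by apply: measurable_fun_rseq => i; exact: mB (t0 i.+1) (t0 i).
have mpre (E : set (rseq R)) : measurable E -> measurable (phi @^-1` E).
  by move=> mE; rewrite -[X in measurable X]setTI; exact: (mphi measurableT).
pose X : {mfun T >-> rseq R} := HB.pack phi (isMeasurableFun.Build _ _ _ _ _ mphi).
have tB a b : (a <= b)%N -> t b - t a = (b - a)%:R / q%:R.
  by move=> ab; rewrite /t natrB// mulrBl; ring.
have tlt a b : (a < b)%N -> t a < t b.
  by move=> ab; rewrite ltrD2l ltr_pM2r ?invr_gt0// ltr_nat.
exists (distribution P X).
  split.
    move=> n A mA; have mono : {homo t : i j / (i <= j)%N >-> i <= j}.
      by move=> i j ij; rewrite lerD2l ler_pM2r ?invr_gt0// ler_nat.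
    have indep := @bm_independent _ _ _ _ _ hB n t (t0 0%N) mono.
    have := indep (fun i : 'I_n => A i) (fun i => mA i).
    rewrite (_ : \bigcap_(i in _) _ = phi @^-1` cylinder n A); last first.
      apply/seteqP; split => w /= h i; first by move=> ilt; exact: (h (Ordinal ilt)).
      by move=> _; exact: h.
    move=> h; apply: (eq_trans h); apply: eq_bigr => i _.
    apply: (eq_trans (bm_gaussian hB (t0 i) (tlt _ _ (ltnSn i)) (mA i))).
    rewrite (tB _ _ (leqnSn i)) subSnn div1r; reflexivity.
  move=> a b ab A mA; rewrite /distribution /pushforward /= -(tB _ _ (ltnW ab)).
  rewrite -(bm_gaussian hB (t0 a) (tlt _ _ ab) mA); congr (P _).
  by apply/seteqP; split => w /=; rewrite bl_grid// ltnW.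
by move=> E mE F; split => //; exact: mpre.
Qed.

Lemma ae_tie_free : {ae P, forall w, tie_free (B ^~ w)}.
Proof.
pose S N a b : set T := [set w | (0 < N)%N /\ (a.+1 < b)%N /\ forall eta : R, 0 < eta ->
  exists M1, forall M, (M1 <= M)%N -> (0 < M)%N ->
  cell_tie M a b eta (grid_increments (B ^~ w) 0 (N * M))].
have nS N a b : P.-negligible (S N a b).
  have [N0|N0] := posnP N.
    rewrite (_ : S N a b = set0); first exact: negligible_set0.
    by apply/seteqP; split => // w []; rewrite N0.
  have [ab|ab] := leqP b a.+1.
    rewrite (_ : S N a b = set0); first exact: negligible_set0.
    by apply/seteqP; split => // w [_ []]; rewrite ltnNge ab.
  apply: negligible_eventually => e e0.
  have NR0 : 0 < Num.sqrt N%:R :> R by rewrite sqrtr_gt0 ltr0n.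
  pose eta := e / Num.sqrt N%:R.
  have eta0 : 0 < eta by exact: divr_gt0.
  exists (fun M => [set w | cell_tie M.+1 a b eta (grid_increments (B ^~ w) 0 (N * M.+1))]).
  have walk M : (0 < N * M.+1)%N by rewrite muln_gt0 N0.
  split.
  - move=> M; have [Q gQ hQ] := brownian_grid_walk (lexx 0) (walk M).
    by have [] := hQ _ (measurable_cell_tie M.+1 a b eta).
  - move=> M; have [Q gQ hQ] := brownian_grid_walk (lexx 0) (walk M).
    have [_ ->] := hQ _ (measurable_cell_tie M.+1 a b eta).
    apply: le_trans (pr_cell_tie N0 (ltn0Sn M) gQ ab (ltW eta0)) _.
    by rewrite /eta divfK// gt_eqF.
  move=> w [_ [_ /(_ eta eta0)[M1 hM1]]]; exists M1 => M M1M; apply: hM1 => //.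
  exact: leqW.
suff -> : {ae P, forall w, tie_free (B ^~ w)} =
   P.-negligible (\bigcup_N \bigcup_a \bigcup_b S N a b) by
  do 3 (apply: negligible_bigcup => ?); exact: nS.
congr (P.-negligible _); apply/seteqP; split => w /=.
  move=> ntf; apply: contrapT => nw; apply: ntf => N a b N0 ab.
  apply: contrapT => neta; apply: nw; exists N => //; exists a => //; exists b => //.
  do 2 split => //; move=> eta eta0; apply: contrapT => nM; apply: neta; exists eta => // M1.
  apply: contrapT => nM1; apply: nM; exists M1 => M M1M M0.
  by apply: contrapT => nt; apply: nM1; exists M.
move=> [N _ [a _ [b _ [N0 [ab hS]]]]] tf.
have [eta eta0 heta] := tf N a b N0 ab.
have [M1 hM1] := hS eta eta0; have [M [M1M M0 nt]] := heta M1.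
by apply: nt; exact: hM1.
Qed.

End brownian_grid.

(** * Covering bad times by countably many windows *)

Section brownian_paths.
Context d (T : measurableType d) (R : realType) (P : probability T R) (B : R -> T -> R).
Hypothesis hB : brownian_motion P B.

Let cont w := {within `[0, +oo[, continuous (B ^~ w)}.
(** The windows have half the length [1/N] of a block, so a minimum is still tested over at least
    [1/(2 N)] after [t]. *)
Let base N i : R := i%:R / (2 * N%:R).

Let base_ge0 N i : 0 <= base N i. Proof. by rewrite divr_ge0// mulr_ge0. Qed.

Let choose_base (t d1 : R) : 0 <= t -> 0 < d1 -> exists N i, [/\ (1 < N)%N,
  base N i <= t, t < base N i + (2 * N%:R)^-1 & N%:R^-1 <= d1].
Proof.
move=> t0 d10; pose N := (Num.truncn d1^-1).+2.
have N0 : 0 < 2 * N%:R :> R by rewrite mulr_gt0// ltr0n.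
have x0 : 0 <= t * (2 * N%:R) by rewrite mulr_ge0// ltW.
have /andP[n1 n2] := truncn_itv x0.
exists N, (Num.truncn (t * (2 * N%:R))); split => //.
- by rewrite /base ler_pdivrMr.
- by move: n2; rewrite -ltr_pdivlMr// -natr1 mulrDl div1r.
- rewrite -[leRHS]invrK lef_pV2 ?posrE ?invr_gt0 ?ltr0n//.
  by apply/ltW/(lt_trans (truncnS_gt _)); rewrite ltr_nat.
Qed.

Let hit_prob_le (p C e S : R) J : 0 <= p -> 0 < e -> J%:R / 2 <= S -> p * S <= C ->
  2 * C <= e * J%:R -> (0 < J)%N -> p <= e.
Proof.
move=> p0 e0 JS pS CJ J0; have JR : 0 < J%:R :> R by rewrite ltr0n.
rewrite -(ler_pM2r JR); have := ler_wpM2l p0 JS; lra.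
Qed.

Let choose_J (C e : R) : 0 < e -> exists2 J, (0 < J)%N & C <= e * J%:R.
Proof.
move=> e0; exists (Num.truncn (C / e)).+1 => //.
by rewrite mulrC -ler_pdivrMr//; exact/ltW/truncnS_gt.
Qed.

Let vervaat_base N i : set T := [set w | (1 < N)%N /\ cont w /\ exists t : R,
  [/\ base N i <= t, t < base N i + (2 * N%:R)^-1,
    forall u, base N i + 1 <= u < t + 1 -> B (t + 1) w < B u w &
    forall u, t < u <= base N i + N%:R^-1 -> B t w < B u w]].

Let negligible_vervaat_base N i : P.-negligible (vervaat_base N i).
Proof.
have [N1|N1] := leqP N 1.
  rewrite (_ : vervaat_base N i = set0); first exact: negligible_set0.
  by apply/seteqP; split => // w []; rewrite ltnNge N1.
have N0 : (0 < N)%N by exact: ltnW.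
apply: negligible_eventually => e e0.
have [J J0 hJ] := choose_J (2 * 32) e0.
pose A L := (2 ^ J * L.+1)%N; pose q L := (N * (4 * A L))%N.
have A0 L : (0 < A L)%N by rewrite /A muln_gt0 expn_gt0.
have q0 L : (0 < q L)%N by rewrite /q muln_gt0 N0 muln_gt0 A0.
exists (fun L => [set w | pair_hit L.+1 (A L) (q L) (grid_increments (B ^~ w) (base N i) (q L))]).
split.
- move=> L; have [Q gQ hQ] := brownian_grid_walk hB (base_ge0 N i) (q0 L).
  by have [] := hQ _ (@measurable_pair_hit R L.+1 (A L) (q L)).
- move=> L; have [Q gQ hQ] := brownian_grid_walk hB (base_ge0 N i) (q0 L).
  have [_ ->] := hQ _ (@measurable_pair_hit R L.+1 (A L) (q L)).
  have LA : (L.+1 <= A L)%N by rewrite /A leq_pmull// expn_gt0.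
  have mq : (4 * A L <= q L)%N by rewrite /q leq_pmull.
  have := pr_pair_hit gQ.1 (@gaussian_step_opp R _ (q0 L)) (gaussian_noatom (q0 L) gQ) LA mq.
  move=> h; apply: (hit_prob_le (pr_ge0 Q _) e0 (harmonic_block R J (ltn0Sn L)) h) => //.
move=> w [_ [cw [t [t1 t2 left right]]]].
have [L0 hL] := eventually_pair_hit cw J N0 (base_ge0 N i) t1 t2 left right.
by exists L0 => L LL; apply: hL => //; exact: leqW.
Qed.

(** The integer [K] localises the increment over [[base, base + 1]]; every path is covered by some
    [K]. *)
Let bridge_base (lambda : R) N i K : set T := [set w | (1 < N)%N /\ cont w /\ exists t : R,
  [/\ base N i <= t, t < base N i + (2 * N%:R)^-1,
    forall u, base N i + 1 <= u < t + 1 -> B (t + 1) w < B u w,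
    B (t + 1) w = B t w + lambda &
    `|B (base N i + 1) w - B (base N i) w - lambda| <= K%:R]].

Let negligible_bridge_base lambda N i K : P.-negligible (bridge_base lambda N i K).
Proof.
have [N1|N1] := leqP N 1.
  rewrite (_ : bridge_base lambda N i K = set0); first exact: negligible_set0.
  by apply/seteqP; split => // w []; rewrite ltnNge N1.
have N0 : (0 < N)%N by exact: ltnW.
have [c c0 hc] := @normal_prob_ball_ge R 18 (ler0n _ _).
apply: negligible_eventually => e e0.
have [J J0 hJ] := choose_J (2 * (144 / c)) e0.
pose A l := (2 ^ J * l.+1)%N; pose q l := (N * (4 * A l))%N.
have A0 l : (0 < A l)%N by rewrite /A muln_gt0 expn_gt0.
have q0 l : (0 < q l)%N by rewrite /q muln_gt0 N0 muln_gt0 A0.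
pose E l : set (rseq R) := bridge_hit (q l) l.+1 (A l) lambda K%:R.
have mE l : measurable (E l) by exact: measurable_bridge_hit.
exists (fun l => [set w | E l (grid_increments (B ^~ w) (base N i) (q l))]).
split.
- move=> l; have [Q gQ hQ] := brownian_grid_walk hB (base_ge0 N i) (q0 l).
  by have [] := hQ _ (mE l).
- move=> l; have [Q gQ hQ] := brownian_grid_walk hB (base_ge0 N i) (q0 l).
  have [_ ->] := hQ _ (mE l).
  have mq : (2 * (4 * A l) <= q l)%N by rewrite /q leq_mul2r N1 orbT.
  have := pr_bridge_hit (q0 l) gQ (ltn0Sn l) (A0 l) mq lambda K%:R c0 hc.
  by move=> h; apply: (hit_prob_le (pr_ge0 Q _) e0 (harmonic_block R J (ltn0Sn l)) h).
move=> w [_ [cw [t [t1 t2 left ft fK]]]].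
have [l0 hl] := eventually_bridge_hit cw J N0 (base_ge0 N i) t1 t2 left ft fK.
by exists l0 => l ll; apply: hl => //; exact: leqW.
Qed.

Lemma ae_no_vervaat : {ae P, forall w, ~ exists t : R, [/\ 0 <= t,
  forall u, t <= u < t + 1 -> B (t + 1) w < B u w &
  exists2 de : R, 0 < de & forall u, t <= u <= t + de -> B t w <= B u w]}.
Proof.
have [N1 [mN1 PN1 hN1]] := bm_continuous hB.
have [N2 [mN2 PN2 hN2]] := ae_tie_free hB.
apply: (@negligibleS _ _ _ _ (N1 `|` N2 `|` \bigcup_N \bigcup_i vervaat_base N i)).
  move=> w /= /contrapT[t [t0 left [de de0 right]]].
  have [cw|ncw] := pselect (cont w); last by left; left; apply: hN1.
  have [tf|ntf] := pselect (tie_free (B ^~ w)); last by left; right; apply: hN2.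
  right; have [d1 /andP[d10 _] sright] := tie_free_strict_right cw tf t0 de0 right.
  have [N [i [N1' i1 i2 Nd]]] := choose_base t0 d10.
  exists N => //; exists i => //; split => //; split => //; exists t; split => //.
    move=> u /andP[u1 u2]; apply: left; apply/andP; split => //.
    (* Hence the second block starts at [base + 1 >= t], inside the range where [left] applies. *)
    have : (2 * N%:R)^-1 <= 1 :> R.
      by rewrite invf_le1 ?mulr_gt0 ?ltr0n ?(ltnW N1')// -natrM ler1n muln_gt0 (ltnW N1').
    lra.
  by move=> u /andP[u1 u2]; apply: sright; rewrite u1 /=; lra.
apply: negligibleU.
  by apply: negligibleU; [exists N1; split|exists N2; split].
by do 2 (apply: negligible_bigcup => ?); exact: negligible_vervaat_base.
Qed.

(** The minimum is weak and [lambda] arbitrary, so that [lambda = 0] covers reflected bridges and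
    excursions; tie-freeness makes the minimum strict near [t + 1]. *)
Lemma ae_no_bridge (lambda : R) : {ae P, forall w, ~ exists t : R, [/\ 0 <= t,
  B (t + 1) w = B t w + lambda & forall u, t <= u <= t + 1 -> B (t + 1) w <= B u w]}.
Proof.
have [N1 [mN1 PN1 hN1]] := bm_continuous hB.
have [N2 [mN2 PN2 hN2]] := ae_tie_free hB.
apply: (@negligibleS _ _ _ _
    (N1 `|` N2 `|` \bigcup_N \bigcup_i \bigcup_K bridge_base lambda N i K)).
  move=> w /= /contrapT[t [t0 ft minf]].
  have [cw|ncw] := pselect (cont w); last by left; left; apply: hN1.
  have [tf|ntf] := pselect (tie_free (B ^~ w)); last by left; right; apply: hN2.
  right.
  have minf' u : t + 1 - 1 <= u <= t + 1 -> B (t + 1) w <= B u w by rewrite addrK; exact: minf.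
  have t11 : 1 <= t + 1 by lra.
  have [d1 /andP[d10 _] sleft] := tie_free_strict_left cw tf ltr01 t11 minf'.
  have [N [i [N1' i1 i2 Nd]]] := choose_base t0 d10.
  exists N => //; exists i => //.
  exists (Num.truncn `|B (base N i + 1) w - B (base N i) w - lambda|).+1 => //.
  split => //; split => //; exists t; split => //.
    move=> u /andP[u1 u2]; apply: sleft; rewrite u2 andbT.
    have N0 : 0 < N%:R :> R by rewrite ltr0n (ltnW N1').
    have : (2 * N%:R)^-1 <= N%:R^-1 :> R.
      by rewrite lef_pV2 ?posrE ?mulr_gt0//; apply: ler_peMl; [exact: ltW|rewrite ler1n].
    lra.
  exact/ltW/truncnS_gt.
apply: negligibleU.
  by apply: negligibleU; [exists N1; split|exists N2; split].
by do 3 (apply: negligible_bigcup => ?); exact: negligible_bridge_base.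
Qed.

Lemma almost_surely_no_embedding_sub (S S' : set (R -> R)) : S `<=` S' ->
  almost_surely_no_embedding P B S' -> almost_surely_no_embedding P B S.
Proof.
move=> SS'; apply: negligibleS => w /= nS nS'; apply: nS => -[t [t0 St]].
by apply: nS'; exists t; split => //; exact: SS'.
Qed.

Lemma no_vervaat_bridge_neg : almost_surely_no_embedding P B (@vervaat_bridge_neg R).
Proof.
apply: negligibleS ae_no_vervaat => w /= nS nS'; apply: nS => -[t [t0 [_ [strict first]]]].
apply: nS'; exists t; split => //.
  move=> u /andP[u1 u2]; have := strict (u - t); rewrite subrKC ltrD2r; apply.
  by apply/andP; split; lra.
(* When the path is never negative the infimum is [+oo], and any positive [r] will do. *)
have [r r0 hr] : exists2 r : R, 0 < r &
    (r%:E <= first_negative_time (fun u : R => (B (t + u) w - B t w)%R))%E.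
  move: first; case: (first_negative_time _) => [r|_|//]; last by exists 1 => //; rewrite leey.
  by rewrite lte_fin => r0; exists r.
(* Halving makes [u - t] strictly less than [r]; the minimum with 1 keeps [u - t] in the range over
   which the infimum is taken. *)
exists (Num.min r 1 / 2); first by rewrite divr_gt0// lt_min r0 ltr01.
have [m1 m2] : Num.min r 1 <= r /\ Num.min r 1 <= 1 by rewrite !ge_min !lexx orbT.
have m0 : 0 < Num.min r 1 by rewrite lt_min r0 ltr01.
move: (Num.min r 1) m0 m1 m2 => m m0 m1 m2.
move=> u /andP[]; rewrite le_eqVlt => /predU1P[<-//|tu ud].
rewrite leNgt; apply/negP => Bu.
have : (r%:E <= (u - t)%R%:E)%E.
  apply: (le_trans hr); apply: ereal_inf_lbound; exists (u - t) => //; split.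
    by apply/andP; split; lra.
  by rewrite subrKC subr_lt0.
by rewrite lee_fin; lra.
Qed.

(** A common superset of the reflected bridges ([lambda = 0]) and of the first passage bridges. *)
Let weak_bridge (lambda : R) : set (R -> R) :=
  [set w | w 1 = lambda /\ forall t, 0 <= t <= 1 -> w 1 <= w t].

Let no_weak_bridge lambda : almost_surely_no_embedding P B (weak_bridge lambda).
Proof.
apply: negligibleS (ae_no_bridge lambda) => w /= nS nS'; apply: nS => -[t [t0 [w1 minw]]].
apply: nS'; exists t; split => //.
  by rewrite -w1 subrKC.
move=> u /andP[u1 u2]; have := minw (u - t); rewrite subrKC lerD2r; apply.
by apply/andP; split; lra.
Qed.

Lemma no_first_passage_bridge lambda :
  almost_surely_no_embedding P B (first_passage_bridge lambda).
Proof.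
apply: almost_surely_no_embedding_sub (no_weak_bridge lambda) => w [_ [w1 hw]]; split => //.
move=> t /andP[t0]; rewrite le_eqVlt => /predU1P[->//|t1].
by apply/ltW/hw; rewrite t0.
Qed.

Lemma no_reflected_bridge : almost_surely_no_embedding P B (@reflected_bridge R).
Proof. by apply: almost_surely_no_embedding_sub (no_weak_bridge 0) => w []. Qed.

Lemma no_excursion : almost_surely_no_embedding P B (@excursion R).
Proof.
apply: almost_surely_no_embedding_sub no_reflected_bridge => w [[cw w0] [w1 hw]].
split => //; split => // t /andP[]; rewrite le_eqVlt => /predU1P[<-|t0].
  by rewrite w1 w0.
rewrite le_eqVlt => /predU1P[->//|t1].
by apply/ltW/hw; rewrite t0.
Qed.

End brownian_paths.

Theorem theorem1p6 (R : realType) (d : measure_display) (T : measurableType d)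
    (P : probability T R) (B : R -> T -> R) (hB : brownian_motion P B) :
  almost_surely_no_embedding P B (@excursion R) /\
  almost_surely_no_embedding P B (@reflected_bridge R) /\
  almost_surely_no_embedding P B (@vervaat_bridge_neg R) /\
  (forall lambda : R, lambda < 0 ->
     almost_surely_no_embedding P B (first_passage_bridge lambda)) /\
  (forall lambda : R, lambda < 0 ->
     almost_surely_no_embedding P B (vervaat_bridge lambda)).
Proof.
split; first exact: no_excursion.
split; first exact: no_reflected_bridge.
split; first exact: no_vervaat_bridge_neg.
split=> lambda _; first exact: no_first_passage_bridge.
by apply: almost_surely_no_embedding_sub (no_first_passage_bridge hB lambda) => w [].
Qed.
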